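(* Let $\mathrm{HL}+(\mathrm{cut})$ be $\mathrm{HL}$ enriched with the cut rule: if $H\to A$ and $G\to B$ are graph sequents and $e_0\in E_G$ is an edge with $lab(e_0)=A$, then from $H\to A$ and $G\to B$ infer $G[e_0/H]\to B$. If a graph sequent $F\to B$ is derivable in $\mathrm{HL}+(\mathrm{cut})$, then it is derivable in $\mathrm{HL}$.
   Context: Hypergraphs: given labels $C$ with $type:C\to\mathbb{N}$, a graph is $G=\langle V,E,att,lab,ext\rangle$ with finite $V,E$, $att:E\to V^\circledast$ (strings of pairwise distinct nodes), $lab:E\to C$ with $type(lab(e))=|att(e)|$, $ext\in V^\circledast$; $type(G)=|ext|$; isomorphic graphs identified. Handle $a^\bullet$: one edge labeled $a$ attached to $v_1\dots v_n$, all external in that order. Replacement $G[e/H]$ ($type(e)=type(H)$): remove $e$, insert a disjoint copy of $H$, fuse the $i$-th external node of $H$ with the $i$-th attachment node of $e$; simultaneous replacement $G[e_1/H_1,\dots,e_k/H_k]$; relabeling $G[e:=a]$. $\mathrm{HL}$: fix primitive types $Pr$ with $type:Pr\to\mathbb{N}$ (infinitely many of each arity); symbol $\$$ of any arity. Types: primitives; $N\div D$ where $D$ is a graph with exactly one edge $d_0$ labeled $\$$ and others labeled by types, $type(N)=type(D)$, $type(N\div D)=type_D(d_0)$; $\times(M)$ for a graph $M$ labeled by types (possibly edgeless), $type(\times(M))=type(M)$. Graph sequent $H\to A$: $H$ a type-labeled graph, $A$ a type, $type(H)=type(A)$. Axioms $p^\bullet\to p$ ($p\in Pr$). Rules: $(\div\to)$: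 for a type $N\div D$ with $E_D=\{d_0,\dots,d_k\}$, $lab(d_0)=\$$, and $e\in E_H$ labeled $N$, from $H\to A$, $H_1\to lab(d_1),\dots,H_k\to lab(d_k)$ infer $H[e/D][d_0:=N\div D][d_1/H_1,\dots,d_k/H_k]\to A$; $(\to\div)$: from $D[d_0/F]\to N$ infer $F\to N\div D$; $(\times\to)$: if $e\in E_G$ is labeled $\times(F)$, from $G[e/F]\to A$ infer $G\to A$; $(\to\times)$: with $E_M=\{m_1,\dots,m_l\}$ ($l\ge0$), from $H_i\to lab(m_i)$ for all $i$ infer $M[m_1/H_1,\dots,m_l/H_l]\to\times(M)$. *)

(* Defs.v *)
From Stdlib Require List.
From mathcomp Require Import all_boot.
Set Implicit Arguments. Unset Strict Implicit. Unset Printing Implicit Defensive.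

(* Concrete hypergraphs labelled by L.                                 *)
(* Nodes are 0, ..., nV-1; edges are the entries of the list [edges],  *)
(* each entry being (label, attachment string); [ext] is the string of *)
(* external nodes.  Isomorphic graphs are identified via [giso_rel]    *)
(* and the isomorphism rule of the calculus.            *)
Record hgraph (L : Type) := HGraph {
  nV : nat;
  edges : seq (L * seq nat);
  ext : seq nat }.
Arguments HGraph {L}.

Definition wf_struct (L : Type) (G : hgraph L) : Prop :=
  (forall x, List.In x (edges G) -> all (fun v => v < nV G) x.2 /\ uniq x.2)
  /\ all (fun v => v < nV G) (ext G) /\ uniq (ext G).

Definition rmap (L L' : Type) (g : L -> L') (G : hgraph L) : hgraph L' :=
  HGraph (nV G) [seq (g x.1, x.2) | x <- edges G] (ext G).

Definition handle (L : Type) (a : L) (n : nat) : hgraph L :=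
  HGraph n [:: (a, iota 0 n)] (iota 0 n).

Definition intn (L : Type) (H : hgraph L) : seq nat :=
  [seq v <- iota 0 (nV H) | v \notin ext H].

(* where node v of H goes when H replaces an edge with attachment att_e,*)
(* the internal nodes of H being numbered from [off] on                *)
Definition embed (L : Type) (att_e : seq nat) (off : nat) (H : hgraph L)
  (v : nat) : nat :=
  if v \in ext H then nth 0 att_e (index v (ext H))
  else off + index v (intn H).

(* simultaneous replacement G[e_1/H_1, ..., e_k/H_k]:                  *)
(* f i = Some H  means edge number i is replaced by H; f i = None      *)
(* means edge i is kept.  The edges of the result are listed edge by   *)
(* edge of G (a kept edge gives itself, a replaced one the edges of H).*)
Definition ninternal (L : Type) (f : nat -> option (hgraph L)) (i : nat) :=
  if f i is Some H then size (intn H) else 0.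

Definition subst (L : Type) (G : hgraph L) (f : nat -> option (hgraph L))
  : hgraph L :=
  let n := size (edges G) in
  let off i := nV G + sumn [seq ninternal f j | j <- iota 0 i] in
  HGraph (off n)
    (flatten [seq (if f p.1 is Some H then
                     [seq (x.1, map (embed p.2.2 (off p.1) H) x.2) | x <- edges H]
                   else [:: p.2])
             | p <- zip (iota 0 n) (edges G)])
    (ext G).

Definition subst1 (L : Type) (G : hgraph L) (e : nat) (H : hgraph L) :=
  subst G (fun i => if i == e then Some H else None).

Definition giso_maps (L L' : Type) (phi sigma : nat -> nat)
  (G : hgraph L) (G' : hgraph L') : Prop :=
  nV G = nV G' /\ size (edges G) = size (edges G') /\
  (forall v, v < nV G -> phi v < nV G') /\
  (forall u v, u < nV G -> v < nV G -> phi u = phi v -> u = v) /\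
  (forall i, i < size (edges G) -> sigma i < size (edges G')) /\
  (forall i j, i < size (edges G) -> j < size (edges G) ->
               sigma i = sigma j -> i = j) /\
  (forall i x y, onth (edges G) i = Some x -> onth (edges G') (sigma i) = Some y ->
                 y.2 = map phi x.2) /\
  ext G' = map phi (ext G).

Definition giso_rel (L L' : Type) (R : L -> L' -> Prop)
  (G : hgraph L) (G' : hgraph L') : Prop :=
  exists (phi sigma : nat -> nat), giso_maps phi sigma G G' /\
    (forall i x y, onth (edges G) i = Some x -> onth (edges G') (sigma i) = Some y ->
                   R x.1 y.1).

(* Types of HL.  Prim p n : primitive type number p of arity n.        *)
(* Div N D : N ÷ D, where D is labelled by option tp, None = $.        *)
(* Times M : ×(M).                                                     *)
Inductive tp : Type :=
| Prim (p n : nat)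
| Div (N : tp) (D : hgraph (option tp))
| Times (M : hgraph tp).

Definition tparity (A : tp) : nat :=
  match A with
  | Prim _ n => n
  | Div _ D => if [seq x.2 | x <- edges D & ~~ isSome x.1] is a :: _ then size a else 0
  | Times M => size (ext M)
  end.

Inductive wf_tp : tp -> Prop :=
| wf_Prim p n : wf_tp (Prim p n)
| wf_Div N D :
    wf_tp N -> wf_struct D ->
    count (fun x => ~~ isSome x.1) (edges D) = 1 ->
    (forall t a, List.In (Some t, a) (edges D) -> wf_tp t /\ tparity t = size a) ->
    tparity N = size (ext D) ->
    wf_tp (Div N D)
| wf_Times M :
    wf_struct M ->
    (forall t a, List.In (t, a) (edges M) -> wf_tp t /\ tparity t = size a) ->
    wf_tp (Times M).

(* isomorphism of types (types containing isomorphic graphs are identified) *)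
Inductive teq : tp -> tp -> Prop :=
| teq_Prim p n : teq (Prim p n) (Prim p n)
| teq_Div N N' D D' (phi sigma : nat -> nat) :
    teq N N' ->
    giso_maps phi sigma D D' ->
    (forall i x y, onth (edges D) i = Some x -> onth (edges D') (sigma i) = Some y ->
       (x.1 = None /\ y.1 = None) \/
       (exists t t', x.1 = Some t /\ y.1 = Some t' /\ teq t t')) ->
    teq (Div N D) (Div N' D')
| teq_Times M M' (phi sigma : nat -> nat) :
    giso_maps phi sigma M M' ->
    (forall i x y, onth (edges M) i = Some x -> onth (edges M') (sigma i) = Some y ->
       teq x.1 y.1) ->
    teq (Times M) (Times M').

Definition giso (G G' : hgraph tp) : Prop := giso_rel teq G G'.

Definition wf_graph (G : hgraph tp) : Prop :=
  wf_struct G /\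
  (forall t a, List.In (t, a) (edges G) -> wf_tp t /\ tparity t = size a).

Definition sequent (H : hgraph tp) (A : tp) : Prop :=
  wf_graph H /\ wf_tp A /\ size (ext H) = tparity A.

Definition dollar_to (A : tp) (o : option tp) : tp :=
  if o is Some t then t else A.

Inductive der (withcut : bool) : hgraph tp -> tp -> Prop :=
| der_ax p n : der withcut (handle (Prim p n) n) (Prim p n)
| der_iso H A H' A' :
    der withcut H A -> giso H H' -> teq A A' -> sequent H' A' ->
    der withcut H' A'
| der_divL (H : hgraph tp) (A N : tp) (D : hgraph (option tp)) (e d0 : nat)
    (a a0 : seq nat) (Hs : nat -> hgraph tp) :
    onth (edges H) e = Some (N, a) ->
    onth (edges D) d0 = Some (None, a0) ->
    der withcut H A ->
    (forall i t b, onth (edges D) i = Some (Some t, b) -> der withcut (Hs i) t) ->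
    (* H[e/D][d0 := N ÷ D][d_1/H_1, ..., d_k/H_k]; the edges of D occupy *)
    (* positions e, ..., e + |E_D| - 1 in H[e/D]                          *)
    sequent (subst (subst1 H e (rmap (dollar_to (Div N D)) D))
                   (fun i => if (e <= i < e + size (edges D)) && (i - e != d0)
                             then Some (Hs (i - e)) else None)) A ->
    der withcut (subst (subst1 H e (rmap (dollar_to (Div N D)) D))
                   (fun i => if (e <= i < e + size (edges D)) && (i - e != d0)
                             then Some (Hs (i - e)) else None)) A
| der_divR (F : hgraph tp) (N : tp) (D : hgraph (option tp)) (d0 : nat) (a0 : seq nat) :
    onth (edges D) d0 = Some (None, a0) ->
    der withcut (subst1 (rmap (dollar_to (Prim 0 0)) D) d0 F) N ->
    sequent F (Div N D) ->
    der withcut F (Div N D)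
| der_timesL (G F : hgraph tp) (A : tp) (e : nat) (a : seq nat) :
    onth (edges G) e = Some (Times F, a) ->
    der withcut (subst1 G e F) A ->
    sequent G A ->
    der withcut G A
| der_timesR (M : hgraph tp) (Hs : nat -> hgraph tp) :
    (forall i t b, onth (edges M) i = Some (t, b) -> der withcut (Hs i) t) ->
    sequent (subst M (fun i => Some (Hs i))) (Times M) ->
    der withcut (subst M (fun i => Some (Hs i))) (Times M)
| der_cut (H G : hgraph tp) (A B : tp) (e0 : nat) (b : seq nat) :
    withcut ->
    der withcut H A -> der withcut G B ->
    onth (edges G) e0 = Some (A, b) ->
    sequent (subst1 G e0 H) B ->
    der withcut (subst1 G e0 H) B.

Notation derHL := (der false).
Notation derHLcut := (der true).

(* Main.v *)
Require Import Defs.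
From Stdlib Require List.
From Stdlib Require Import Permutation.
From mathcomp Require Import all_boot zify.
Set Implicit Arguments. Unset Strict Implicit. Unset Printing Implicit Defensive.

(* Replace a concrete graph by a named one: a list I of internal
   names, a list E of labelled edges attached to names, and the list X of
   external names.  When the names of H are chosen so that its external nodes
   are the attachment of e and its internal ones are fresh, G[e/H] is obtained
   by concatenating the internal names and the remaining edges, so that
   replacement is associative and commutative up to permutation.  In the
   resulting cut-free calculus nd only the rules (->÷) and (×->) have premises
   with names that are absent from the conclusion; like eigenvariables these
   are quantified over all fresh instances of the graph.  A cut is then pushed
   upwards without ever renaming a derivation: induction on the cut type, then
   on the left derivation, then on the right one.  The calculus nd is
   equivalent to cut-free HL, and it also interprets HL with cut. *)

(** * Isomorphism of types and of graphs *)

(** Quantifying over instances removes renaming for the following reason. A cut only enlarges the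
    sequent, and an instance that is fresh for the larger sequent is fresh for the premise of the
    smaller one; the induction hypothesis therefore applies to that very instance. In a principal
    cut one of the two rules quantifies over instances while its partner carries fixed names [r] of
    the graph in question: (÷->) carries names of the denominator and (->×) names of the product
    graph. Taking the quantified premise at these names makes all nodes to be fused literally equal,
    and the smaller cuts can be performed at once. The other complication is that types are
    identified up to isomorphism. The edge that is cut bears a type merely [teq] to the cut type, so
    the two rules of a principal cut speak of isomorphic graphs, and the instance to take is [r]
    composed with the isomorphism. *)

Lemma tp_nested_ind (P : tp -> Prop) :
  (forall p n, P (Prim p n)) ->
  (forall N D, P N -> (forall t a, List.In (Some t, a) (edges D) -> P t) ->
     P (Div N D)) ->
  (forall M, (forall t a, List.In (t, a) (edges M) -> P t) -> P (Times M)) ->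
  forall A, P A.
Proof.
(* The generated principle has no hypothesis for types inside edge lists. The inner inductions on
   the list reach them while keeping the recursive calls guarded. *)
move=> Pprim Pdiv Ptimes; fix IH 1 => -[p n|N [n es x]|[n es x]].
- exact: Pprim.
- apply: Pdiv => /=; first exact: IH.
  elim: es => [|[[t'|] b] es IHes] t a /=; first by case.
  + case=> [[<- _]|H]; [exact: IH | exact: IHes H].
  (* [IH] is cleared because the closing tactic could otherwise apply it to [t] itself, which is not
     a guarded call. *)
  + by clear IH; case=> [|/IHes].
- apply: Ptimes => /=.
  elim: es => [|[t' b] es IHes] t a /=; first by case.
  case=> [[<- _]|H]; [exact: IH | exact: IHes H].
Qed.

(** * Lists compared by a relation, up to permutation *)

Lemma In_onth T (s : seq T) x : List.In x s <-> exists i, onth s i = Some x.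
Proof.
elim: s => [|y s IH] /=; first by split=> // -[i]; rewrite onth0n.
split=> [[->|/IH[i si]]|[[|i] /= si]]; first by exists 0.
- by exists i.+1.
- by case: si; left.
- by right; apply/IH; exists i.
Qed.

Lemma onth_nth_error T (s : seq T) i : onth s i = List.nth_error s i.
Proof. by elim: s i => [|x s IH] [|i] /=. Qed.

Lemma perm_eq_Permutation (T : eqType) (s t : seq T) :
  perm_eq s t -> Permutation s t.
Proof.
elim: s t => [|x s IH] t; first by rewrite perm_sym => /perm_nilP->.
move=> pst; have xt : x \in t by rewrite -(perm_mem pst) mem_head.
case/splitPr: xt pst => t1 t2; rewrite perm_sym perm_catC /= perm_cons perm_catC.
by rewrite perm_sym => /IH pst; apply: Permutation_cons_app.
Qed.

Lemma Perm_map X Y (f : X -> Y) l l' :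
  Permutation l l' -> Permutation (map f l) (map f l').
Proof. exact (@Permutation_map X Y f l l'). Qed.

Lemma Perm_map_inv X Y (f : X -> Y) l l' :
  Permutation l (map f l') -> exists2 m, l = map f m & Permutation m l'.
Proof.
by case/(@Permutation_map_inv X Y f l l')=> m [-> /Permutation_sym]; exists m.
Qed.

Lemma Forall2_map2 I X Y (R : X -> Y -> Prop) f g (s : seq I) :
  (forall i, List.In i s -> R (f i) (g i)) -> List.Forall2 R (map f s) (map g s).
Proof.
elim: s => [|i s IH] Rs /=; constructor; first by apply: Rs; left.
by apply: IH => j sj; apply: Rs; right.
Qed.

Lemma Forall2_onth X Y (R : X -> Y -> Prop) l l' : List.Forall2 R l l' ->
  forall i x y, onth l i = Some x -> onth l' i = Some y -> R x y.
Proof.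
elim=> {l l'} [i x y|x y l l' Rxy _ IH [|i] x' y' /=]; first by rewrite onth0n.
- by move=> [<-] [<-].
- exact: IH.
Qed.

Lemma Forall2_size X Y (R : X -> Y -> Prop) l l' : List.Forall2 R l l' ->
  size l = size l'.
Proof. by elim=> //= *; congr _.+1. Qed.

Lemma Forall2_In X Y (R : X -> Y -> Prop) l l' : List.Forall2 R l l' ->
  List.Forall2 (fun x y => [/\ R x y, List.In x l & List.In y l']) l l'.
Proof.
elim=> {l l'} [|x y l l' Rxy _ IH]; constructor; first by split=> //; left.
by apply: List.Forall2_impl IH => u v [? ? ?]; split=> //; right.
Qed.

Lemma Permutation_size T (l l' : seq T) : Permutation l l' -> size l = size l'.
Proof. by elim=> {l l'} //= [*|l1 l2 l3 _ -> _ ->]; first by congr _.+1. Qed.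

(** Edge lists matter only as multisets. This relation asks for a matching of the two lists with all
    pairs in [R] and hides the index map [sigma] of [giso_maps]. *)
Definition permR X Y (R : X -> Y -> Prop) l l' :=
  exists2 l1, List.Forall2 R l l1 & Permutation l1 l'.

Lemma permR_size X Y (R : X -> Y -> Prop) l l' : permR R l l' -> size l = size l'.
Proof. by case=> l1 /Forall2_size-> /Permutation_size. Qed.

(** An injection between index sets of equal size is a bijection, so reading [l'] in the order given
    by [sigma] permutes it. *)
Lemma permR_onth X Y (R : X -> Y -> Prop) l l' (sigma : nat -> nat) :
  size l = size l' ->
  (forall i, i < size l -> sigma i < size l') ->
  (forall i j, i < size l -> j < size l -> sigma i = sigma j -> i = j) ->
  (forall i x y, onth l i = Some x -> onth l' (sigma i) = Some y -> R x y) ->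
  permR R l l'.
Proof.
case: l l' => [|d l0] [|d' l'0] //; first by exists [::].
set l := d :: l0; set l' := d' :: l'0 => eqsz lts injs Rs.
exists [seq nth d' l' (sigma i) | i <- iota 0 (size l)].
  rewrite -{1}(mkseq_nth d l); apply: Forall2_map2 => i.
  have: i \in iota 0 (size l) -> R (nth d l i) (nth d' l' (sigma i)).
    rewrite mem_iota add0n => /= li; apply: (Rs i).
      by rewrite onthE (nth_map d).
    by rewrite onthE (nth_map d') // lts.
  move=> H /In_onth[j lj]; apply: H; apply/onthP; by exists j.
rewrite -{2}(mkseq_nth d' l') /mkseq (map_comp (nth d' l') sigma).
apply: Perm_map; apply: perm_eq_Permutation.
have us : uniq (map sigma (iota 0 (size l))).
  rewrite map_inj_in_uniq ?iota_uniq // => i j; rewrite !mem_iota !add0n.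
  exact: injs.
apply: uniq_perm => //; rewrite ?iota_uniq //.
apply: (uniq_min_size us _ _).2; last by rewrite size_map !size_iota eqsz.
by move=> i /mapP[j]; rewrite !mem_iota !add0n => /lts + ->.
Qed.

Lemma onth_permR X Y (R : X -> Y -> Prop) l l' : permR R l l' ->
  exists sigma,
  [/\ forall i, i < size l -> sigma i < size l',
      forall i j, i < size l -> j < size l -> sigma i = sigma j -> i = j &
      forall i x y, onth l i = Some x -> onth l' (sigma i) = Some y -> R x y].
Proof.
case=> l1 Rl /[dup] /Permutation_size eql1 /Permutation_sym.
move=> /Permutation_nth_error[_ [f [injf nthf]]]; exists f; split.
- move=> i; rewrite (Forall2_size Rl) -onthTE onth_nth_error nthf.
  by rewrite -onth_nth_error onthTE.
- by move=> i j _ _ /injf.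
- move=> i x y lx; rewrite onth_nth_error -nthf -onth_nth_error => ly.
  exact: (Forall2_onth Rl lx ly).
Qed.

Lemma permR_impl X Y (R S : X -> Y -> Prop) l l' : permR R l l' ->
  (forall x y, List.In x l -> List.In y l' -> R x y -> S x y) -> permR S l l'.
Proof.
case=> l1 /Forall2_In Rl pl RS; exists l1 => //.
apply: List.Forall2_impl Rl => x y [Rxy lx ly]; apply: RS => //.
exact: Permutation_in pl ly.
Qed.

Lemma permR_trans X Y Z (R : X -> Y -> Prop) (S : Y -> Z -> Prop) l1 l2 l3 :
  permR R l1 l2 -> permR S l2 l3 ->
  permR (fun x z => exists2 y, R x y & S y z) l1 l3.
Proof.
case=> m Rl pm [m' Sl pm'].
have [m2 [pm2 Sm]] := Permutation_Forall2 (Permutation_sym pm) Sl.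
exists m2; last exact: Permutation_trans (Permutation_sym pm2) pm'.
elim: Rl m2 Sm {pm pm2} => [|x y l l' Rxy _ IH] m2 Sm.
  by inversion Sm; constructor.
by inversion Sm; subst; constructor; [exists y | apply: IH].
Qed.

Lemma permR_sym X Y (R : X -> Y -> Prop) l l' : permR R l l' ->
  permR (fun y x => R x y) l' l.
Proof.
case=> m /List.Forall2_flip Rl pm.
by have [m2 [pm2 Sm]] := Permutation_Forall2 pm Rl; exists m2 => //; apply: Permutation_sym.
Qed.

Lemma permR_refl X (R : X -> X -> Prop) l :
  (forall x, List.In x l -> R x x) -> permR R l l.
Proof.
move=> Rx; exists l => //.
by rewrite -(map_id l); apply: Forall2_map2.
Qed.

Lemma permR_map X Y X' Y' (R : X -> Y -> Prop) (f : X' -> X) (g : Y' -> Y) l l' :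
  permR (fun x y => R (f x) (g y)) l l' -> permR R (map f l) (map g l').
Proof.
case=> m Rl pm; exists (map g m); last exact: Perm_map.
by elim: Rl => //= *; constructor.
Qed.

Lemma permR_map_inv X Y X' Y' (R : X -> Y -> Prop) (f : X' -> X) (g : Y' -> Y) l l' :
  permR R (map f l) (map g l') -> permR (fun x y => R (f x) (g y)) l l'.
Proof.
case=> m Rl /Perm_map_inv[m' em pm]; exists m' => //.
rewrite {}em {pm} in Rl; elim: l m' Rl => [|x l IH] [|y m'] Rl; inversion Rl; subst.
  by constructor.
by constructor=> //; apply: IH.
Qed.

Lemma permR_Permr X Y (R : X -> Y -> Prop) l1 l l' :
  Permutation l l1 -> permR R l' l -> permR R l' l1.
Proof. by move=> pl [m Rl pm]; exists m => //; exact: Permutation_trans pm pl. Qed.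

Lemma permR_cat X Y (R : X -> Y -> Prop) l1 l2 m1 m2 :
  permR R l1 m1 -> permR R l2 m2 -> permR R (l1 ++ l2) (m1 ++ m2).
Proof.
move=> [k1 Rl1 pm1] [k2 Rl2 pm2]; exists (k1 ++ k2).
  exact: List.Forall2_app.
exact: Permutation_app.
Qed.

Lemma permR_In X Y (R : X -> Y -> Prop) l l' y : permR R l l' ->
  List.In y l' -> exists2 x, List.In x l & R x y.
Proof.
case=> m /Forall2_In Rl /Permutation_sym pm /(Permutation_in _ pm) /In_onth[i mi].
have: i < size m by rewrite -onthTE mi.
rewrite -(Forall2_size Rl) -onthTE; case E: onth => [x|] // _.
by have [? ? ?] := Forall2_onth Rl E mi; exists x.
Qed.

(** Traces one edge back through a matching; in this way the cut edge is found again in the premise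
    of [nd_iso]. *)
Lemma permR_consr X Y (R : X -> Y -> Prop) l l' y : permR R l (y :: l') ->
  exists x l0, [/\ Permutation l (x :: l0), R x y & permR R l0 l'].
Proof.
case=> m Rl /Permutation_sym pm.
have [m1 [m2 em]] : exists m1 m2, m = m1 ++ y :: m2.
  by apply: List.in_split; apply: Permutation_in pm _; left.
subst m; have [k1 [k2 [Rk1 [Rk2 ek]]]] := List.Forall2_app_inv_r _ _ Rl.
inversion Rk2 as [|x y0 k3 l3 Rxy Rk3]; subst; exists x, (k1 ++ k3); split=> //.
  exact/Permutation_sym/Permutation_cons_app.
exists (m1 ++ m2); first exact: List.Forall2_app.
exact/Permutation_sym/(Permutation_cons_app_inv _ _ pm).
Qed.

(** * Isomorphisms as maps on nodes *)

Definition inj_on n (r : nat -> nat) :=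
  forall u v, u < n -> v < n -> r u = r v -> u = v.

(** The relation [giso_rel] with the node map exposed and the edge map absorbed by [permR], so that
    composition and inversion deal with node maps only. *)
Definition isoR L L' (phi : nat -> nat) (R : L -> L' -> Prop) G G' :=
  [/\ nV G = nV G', forall v, v < nV G -> phi v < nV G', inj_on (nV G) phi,
      ext G' = map phi (ext G) &
      permR (fun x y => R x.1 y.1 /\ y.2 = map phi x.2) (edges G) (edges G')].

Lemma giso_relE L L' (R : L -> L' -> Prop) G G' :
  giso_rel R G G' <-> exists phi, isoR phi R G G'.
Proof.
split=> [[phi [sigma [[? [eqsz [? [? [lts [injs [atts exts]]]]]]] Rs]]]|].
  exists phi; split=> //; apply: (permR_onth eqsz lts injs) => i x y Gx Gy.
  by split; [apply: Rs Gx Gy | apply: atts Gx Gy].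
case=> phi [? ? ? ? /[dup] /permR_size eqsz /onth_permR[sigma [? ? Rs]]].
exists phi, sigma; split; last by move=> i x y Gx Gy; case: (Rs i x y Gx Gy).
by do !split=> //; move=> i x y Gx Gy; case: (Rs i x y Gx Gy).
Qed.

Definition optR (R : tp -> tp -> Prop) (x y : option tp) :=
  (x = None /\ y = None) \/ (exists t t', [/\ x = Some t, y = Some t' & R t t']).

Lemma teq_DivE N D B : teq (Div N D) B <->
  exists N' D' phi, [/\ B = Div N' D', teq N N' & isoR phi (optR teq) D D'].
Proof.
split=> [H|[N' [D' [phi [-> tN iD]]]]].
  inversion H as [|N0 N' D0 D' phi sigma tN jD RD|]; subst.
  have: giso_rel (optR teq) D D'.
    exists phi, sigma; split=> // i x y Dx Dy.
    by case: (RD i x y Dx Dy) => [|[t [t' [? [? ?]]]]]; [left|right; exists t, t'].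
  by case/giso_relE=> psi iD; exists N', D', psi.
have [|psi [sigma [i1 i2]]] := (giso_relE (optR teq) D D').2; first by exists phi.
apply: (teq_Div tN i1) => i x y Dx Dy.
by case: (i2 i x y Dx Dy) => [|[t [t' [? ? ?]]]]; [left|right; exists t, t'].
Qed.

Lemma teq_TimesE M B : teq (Times M) B <->
  exists M' phi, B = Times M' /\ isoR phi teq M M'.
Proof.
split=> [H|[M' [phi [-> iM]]]].
  inversion H as [| |M0 M' phi sigma iM RM]; subst.
  have: giso_rel teq M M' by exists phi, sigma.
  by case/giso_relE=> psi iD; exists M', psi.
have [|psi [sigma [i1 i2]]] := (giso_relE teq M M').2; first by exists phi.
exact: (teq_Times i1).
Qed.

Lemma isoR_refl L (R : L -> L -> Prop) G :
  (forall x, List.In x (edges G) -> R x.1 x.1) -> isoR id R G G.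
Proof.
move=> RG; split; rewrite ?map_id //.
by apply: permR_refl => x Gx; split; [apply: RG | rewrite map_id].
Qed.

Lemma isoR_comp L L' L'' (R : L -> L' -> Prop) (S : L' -> L'' -> Prop) phi psi
    G G' G'' :
  isoR phi R G G' -> isoR psi S G' G'' ->
  isoR (psi \o phi) (fun x z => exists2 y, R x y & S y z) G G''.
Proof.
move=> [n1 lt1 inj1 ext1 R1] [n2 lt2 inj2 ext2 R2]; split.
- by rewrite n1.
- by move=> v /lt1; rewrite ?n1 => /lt2.
- move=> u v ltu ltv /inj2 => /(_ (lt1 _ ltu) (lt1 _ ltv)); exact: inj1.
- by rewrite ext2 ext1 -map_comp.
- apply: permR_impl (permR_trans R1 R2) _ => x z _ _ [y [Rxy ey] [Syz ez]].
  by split; [exists y.1 | rewrite ez ey -map_comp].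
Qed.

Lemma isoR_impl L L' (R S : L -> L' -> Prop) phi G G' : isoR phi R G G' ->
  (forall x y, List.In x (edges G) -> List.In y (edges G') -> R x.1 y.1 -> S x.1 y.1) ->
  isoR phi S G G'.
Proof.
move=> [? ? ? ? RG] RS; split=> //; apply: permR_impl RG _.
by move=> x y Gx Gy [Rxy ->]; split=> //; apply: RS.
Qed.

Lemma isoR_nodes L L' (R : L -> L' -> Prop) phi G G' : isoR phi R G G' ->
  perm_eq (map phi (iota 0 (nV G))) (iota 0 (nV G')).
Proof.
move=> [n1 lt1 inj1 _ _].
have us : uniq (map phi (iota 0 (nV G))).
  rewrite map_inj_in_uniq ?iota_uniq // => u v; rewrite !mem_iota !add0n.
  exact: inj1.
apply: uniq_perm; rewrite ?iota_uniq //.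
apply: (uniq_min_size us _ _).2; last by rewrite size_map !size_iota n1.
by move=> i /mapP[j]; rewrite !mem_iota !add0n => /lt1 + ->.
Qed.

(* Well-formedness is needed: an ill-formed attachment may leave the range of
   the nodes, where phi is arbitrary. *)
Lemma isoR_sym L L' (R : L -> L' -> Prop) phi G G' : wf_struct G ->
  isoR phi R G G' -> exists psi, isoR psi (fun y x => R x y) G' G.
Proof.
move=> [wfe [/allP wfx _]] iG; have [n1 lt1 inj1 ext1 R1] := iG.
pose s := map phi (iota 0 (nV G)); pose psi w := index w s.
have ps : perm_eq s (iota 0 (nV G')) := isoR_nodes iG.
have us : uniq s by rewrite (perm_uniq ps) iota_uniq.
have phiK v : v < nV G -> psi (phi v) = v.
  move=> ltv; have <-: nth 0 s v = phi v.
    by rewrite (nth_map 0) ?size_iota // nth_iota.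
  by rewrite /psi index_uniq // size_map size_iota.
have s_mem w : w < nV G' -> w \in s by rewrite (perm_mem ps) mem_iota.
have mapK a : all (fun v => v < nV G) a -> map psi (map phi a) = a.
  by move=> /allP wa; rewrite -map_comp -[RHS]map_id; apply/eq_in_map => v /wa/phiK.
exists psi; split=> //.
- move=> w ltw; rewrite /psi -[nV G](size_iota 0) -(size_map phi) index_mem.
  exact: s_mem.
- move=> u v /s_mem su /s_mem sv euv.
  by rewrite -(nth_index 0 su) -(nth_index 0 sv) -/(psi u) euv.
- by rewrite ext1 mapK //; apply/allP.
- apply: permR_impl (permR_sym R1) _ => y x _ Gx [Rxy ->]; split=> //.
  by rewrite mapK //; case: (wfe _ Gx).
Qed.

Lemma teq_refl A : teq A A.
Proof.
elim/tp_nested_ind: A => [p n|N D IHN IHD|M IHM]; first by constructor.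
- apply/teq_DivE; exists N, D, id; split=> //; apply: isoR_refl => -[[t|] a] /= Da.
    by right; exists t, t; split=> //; apply: IHD Da.
  by left.
- apply/teq_TimesE; exists M, id; split=> //; apply: isoR_refl => -[t a] /=.
  exact: IHM.
Qed.

Lemma teq_trans A B C : teq A B -> teq B C -> teq A C.
Proof.
elim/tp_nested_ind: A B C => [p n|N D IHN IHD|M IHM] B C.
- by move=> H; inversion H.
- move=> /teq_DivE[N' [D' [phi [-> tN iD]]]] /teq_DivE[N'' [D'' [psi [-> tN' iD']]]].
  apply/teq_DivE; exists N'', D'', (psi \o phi); split=> //; first exact: IHN tN'.
  apply: isoR_impl (isoR_comp iD iD') _ => -[x a] [z c] /= Dx _ [y].
  case=> [[-> ->]|[t [t' [ex -> tt]]]] [[// _ ->]|[u [u' [// [<-] -> uu]]]]; first by left.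
  by right; exists t, u'; split=> //; apply: IHD uu => //; rewrite ex in Dx; exact: Dx.
- move=> /teq_TimesE[M' [phi [-> iM]]] /teq_TimesE[M'' [psi [-> iM']]].
  apply/teq_TimesE; exists M'', (psi \o phi); split=> //.
  apply: isoR_impl (isoR_comp iM iM') _ => -[x a] [z c] /= Mx _ [y Rxy].
  exact: IHM Mx _ _ Rxy.
Qed.

Lemma teq_sym A B : wf_tp A -> teq A B -> teq B A.
Proof.
elim/tp_nested_ind: A B => [p n|N D IHN IHD|M IHM] B wA.
- by move=> H; inversion H; constructor.
- inversion wA as [|N0 D0 wN wD _ wl _|]; subst.
  move=> /teq_DivE[N' [D' [phi [-> tN iD]]]].
  have [psi iD'] := isoR_sym wD iD.
  apply/teq_DivE; exists N, D, psi; split=> //; first exact: IHN.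
  apply: isoR_impl iD' _ => -[y b] [x a] /= _ Dx.
  case=> [[-> ->]|[t [t' [ex -> tt]]]]; first by left.
  right; exists t', t; split=> //; rewrite {}ex in Dx.
  by have [wx _] := wl _ _ Dx; apply: IHD Dx _ wx tt.
- inversion wA as [| |M0 wM wl]; subst.
  move=> /teq_TimesE[M' [phi [-> iM]]].
  have [psi iM'] := isoR_sym wM iM.
  apply/teq_TimesE; exists M, psi; split=> //.
  apply: isoR_impl iM' _ => -[y b] [x a] /= _ Mx.
  by have [wx _] := wl _ _ Mx; apply: IHM Mx _ wx.
Qed.

(** * The named calculus *)

Section PermTactic.
Variable T : Type.
Implicit Types s : seq T.

Lemma Perm_catl s s1 s2 : Permutation s1 s2 -> Permutation (s ++ s1) (s ++ s2).
Proof. exact (@Permutation_app_head T s s1 s2). Qed.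

Lemma Perm_catr s s1 s2 : Permutation s1 s2 -> Permutation (s1 ++ s) (s2 ++ s).
Proof. exact (@Permutation_app_tail T s1 s2 s). Qed.

Lemma Perm_catC s1 s2 : Permutation (s1 ++ s2) (s2 ++ s1).
Proof. exact (@Permutation_app_comm T s1 s2). Qed.

Lemma Perm_cat_cons x s1 s2 : Permutation (s1 ++ x :: s2) (x :: s1 ++ s2).
Proof. exact/Permutation_sym/Permutation_middle. Qed.

Lemma In_cat x s1 s2 : List.In x (s1 ++ s2) <-> List.In x s1 \/ List.In x s2.
Proof. exact (List.in_app_iff s1 s2 x). Qed.

Lemma In_split x s : List.In x s -> exists s1 s2, s = s1 ++ x :: s2.
Proof. exact (@List.in_split T x s). Qed.

(** Hides the [::] of a one-element list, so that [cons_sing] can be rewritten exhaustively without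
    looping. *)
Definition sing (x : T) := [:: x].

Lemma cons_sing x s : x :: s = sing x ++ s. Proof. by []. Qed.

Lemma Perm_bring s1 s2 s3 s4 :
  Permutation (s1 ++ s3) s4 -> Permutation (s1 ++ s2 ++ s3) (s2 ++ s4).
Proof.
move=> p; rewrite catA; apply: (@Permutation_trans _ _ ((s2 ++ s1) ++ s3)).
  exact/Perm_catr/Perm_catC.
by rewrite -catA; apply: Perm_catl.
Qed.

Lemma Perm_step s1 s2 s3 s4 :
  Permutation (s1 ++ s3) s4 -> Permutation s2 s3 -> Permutation (s1 ++ s2) s4.
Proof.
by move=> p q; apply: Permutation_trans p; apply: Perm_catl.
Qed.

Lemma Perm_cats0 s1 s2 :
  Permutation (s1 ++ [::]) (s2 ++ [::]) -> Permutation s1 s2.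
Proof. by rewrite !cats0. Qed.

End PermTactic.

(** Both sides are concatenations of blocks, closed by [[::]]. [Perm_step] takes the first block on
    the left; [perm_bring] looks for it on the right, and each block skipped by [Perm_bring] is
    recorded in the existential list that becomes the new right side. *)
Ltac perm_bring :=
  first [ exact: Permutation_refl | apply: Perm_bring; perm_bring ].
Ltac perm_cat :=
  apply: Perm_cats0; rewrite ?cons_sing -?catA ?cat0s;
  repeat (first [ exact: Permutation_refl | eapply Perm_step; [ perm_bring | ] ]).

(** The case distinction for a context assembled from several premises: the cut edge [x] comes from
    one of the two parts. *)
Lemma Perm_cons_cat T (x : T) s1 s2 s :
  Permutation (s1 ++ s2) (x :: s) ->
  (exists2 s1', Permutation s1 (x :: s1') & Permutation s (s1' ++ s2)) \/
  (exists2 s2', Permutation s2 (x :: s2') & Permutation s (s1 ++ s2')).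
Proof.
move=> p; have: List.In x (s1 ++ s2).
  by apply: Permutation_in (Permutation_sym p) _; left.
move/In_cat=> [] h; have [l1 [l2 e]] := In_split h; subst; [left|right];
  exists (l1 ++ l2); try exact: Perm_cat_cons.
- apply: (@Permutation_cons_inv _ _ _ x); apply: Permutation_trans (Permutation_sym p) _.
  by perm_cat.
- apply: (@Permutation_cons_inv _ _ _ x); apply: Permutation_trans (Permutation_sym p) _.
  by perm_cat.
Qed.

(** Separates the case of a principal cut edge, [x = y], from that of a cut edge in the context of
    the rule. *)
Lemma Perm_cons_cons T (x y : T) s1 s :
  Permutation (y :: s1) (x :: s) ->
  (x = y /\ Permutation s1 s) \/
  (exists2 s1', Permutation s1 (x :: s1') & Permutation s (y :: s1')).
Proof.
case/(@Perm_cons_cat _ _ [:: y]) => [[s' p q]|]; last by right.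
left; have /= := Permutation_size p; case: s' p q => // p q _.
by have [->] := Permutation_length_1_inv p; split=> //; apply: Permutation_sym.
Qed.

(** Every freshness condition is the uniqueness of a concatenation. Read as a bound on the number of
    occurrences of each name, it is linear arithmetic: concatenation becomes addition, and [lia]
    decides the rest. *)
Lemma uniq_countP (s : seq nat) : reflect (forall x, count_mem x s <= 1) (uniq s).
Proof.
apply: (iffP idP) => [us x|le1]; first by rewrite count_uniq_mem //; case: (_ \in _).
elim: s le1 => //= y s IH le1; rewrite IH ?andbT => [|x]; last first.
  by apply: leq_trans (le1 x); rewrite leq_addl.
by have := le1 y; rewrite eqxx -has_pred1 has_count; case: count.
Qed.

Lemma mem_countE (x : nat) s : (x \in s) = (0 < count_mem x s).
Proof. by rewrite -has_pred1 has_count. Qed.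

Lemma eq_count_perm (s t : seq nat) :
  (forall x, count_mem x s = count_mem x t) -> perm_eq s t.
Proof. by move=> e; apply/allP=> x _ /=; rewrite e. Qed.

(** The edges of a graph under a naming [r] of its nodes. The other two components of the named copy
    are [map r (intn G)] and [map r (ext G)]. *)
Definition rn L (r : nat -> nat) (l : seq (L * seq nat)) :=
  [seq (x.1, map r x.2) | x <- l].

(** Applied to the edges of a denominator, it drops the [$]-edge. *)
Definition somes L (l : seq (option L * seq nat)) : seq (L * seq nat) :=
  pmap (fun x => omap (fun t => (t, x.2)) x.1) l.

Notation eqe := (fun x y : tp * seq nat => teq x.1 y.1 /\ y.2 = x.2).

(** The counterpart of [sequent]. The nodes are the names in [I ++ X], so isolated nodes are
    recorded although no edge mentions them. *)
Definition wfs I (E : seq (tp * seq nat)) (X : seq nat) A :=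
  [/\ uniq (I ++ X),
      forall t a, List.In (t, a) E ->
        [/\ wf_tp t, tparity t = size a, uniq a & {subset a <= I ++ X}],
      wf_tp A & size X = tparity A].

(** [nd_iso] reorders and exchanges isomorphic types but leaves every name alone. In [nd_divR] the
    sequent takes the place of the [$]-edge, so its external names are those of [a0], and [I] has to
    avoid all nodes of [D]. In [nd_timesL] the external nodes of [M] receive names [a] that exist
    already, so only its internal nodes have to be fresh. [nds] collects one premise for each
    labeled edge of a list and concatenates their internal names and edges. *)
Inductive nd : seq nat -> seq (tp * seq nat) -> seq nat -> tp -> Prop :=
| nd_ax p n a : uniq a -> size a = n -> nd [::] [:: (Prim p n, a)] a (Prim p n)
| nd_iso I E X A I' E' A' :
    nd I E X A -> perm_eq I I' -> permR eqe E E' -> teq A A' ->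
    wfs I' E' X A' -> nd I' E' X A'
| nd_divL I E X A N D r a0 J F :
    List.In (None, a0) (edges D) -> inj_on (nV D) r ->
    nd I ((N, map r (ext D)) :: E) X A ->
    nds (rn r (edges D)) J F ->
    wfs (I ++ map r (intn D) ++ J) ((Div N D, map r a0) :: E ++ F) X A ->
    nd (I ++ map r (intn D) ++ J) ((Div N D, map r a0) :: E ++ F) X A
| nd_divR I E X N D a0 :
    List.In (None, a0) (edges D) ->
    (forall r, inj_on (nV D) r -> map r a0 = X ->
       uniq (I ++ map r (iota 0 (nV D))) ->
       nd (map r (intn D) ++ I) (somes (rn r (edges D)) ++ E) (map r (ext D)) N) ->
    wfs I E X (Div N D) ->
    nd I E X (Div N D)
| nd_timesL I E X A M a :
    (forall r, inj_on (nV M) r -> map r (ext M) = a ->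
       uniq ((I ++ map r (intn M)) ++ X) ->
       nd (I ++ map r (intn M)) (rn r (edges M) ++ E) X A) ->
    wfs I ((Times M, a) :: E) X A ->
    nd I ((Times M, a) :: E) X A
| nd_timesR M r J F :
    inj_on (nV M) r ->
    nds (rn r [seq (Some x.1, x.2) | x <- edges M]) J F ->
    wfs (map r (intn M) ++ J) F (map r (ext M)) (Times M) ->
    nd (map r (intn M) ++ J) F (map r (ext M)) (Times M)
with nds : seq (option tp * seq nat) -> seq nat -> seq (tp * seq nat) -> Prop :=
| nds_nil : nds [::] [::] [::]
| nds_none b T J F : (* the $-edge has no premise *)
    nds T J F -> nds ((None, b) :: T) J F
| nds_some t b T J1 F1 J F :
    nd J1 F1 b t -> nds T J F -> nds ((Some t, b) :: T) (J1 ++ J) (F1 ++ F).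

Scheme nd_mut := Minimality for nd Sort Prop
with nds_mut := Minimality for nds Sort Prop.

Lemma nd_wfs I E X A : nd I E X A -> wfs I E X A.
Proof.
case=> // p n a ua sa; split=> //=; last by constructor.
by move=> t b [[<- <-]|//]; split=> //; constructor.
Qed.

Lemma wfs_perm I E X A I' E' : wfs I E X A -> perm_eq I I' -> Permutation E E' ->
  wfs I' E' X A.
Proof.
move=> [uIX wE wA sX] pI /Permutation_sym pE; split=> //.
  by rewrite -(perm_uniq (_ : perm_eq (I ++ X) _)) // perm_cat2r.
move=> t a /(Permutation_in _ pE)/wE[? ? ? sub]; split=> // x /sub.
by rewrite !mem_cat (perm_mem pI).
Qed.

Lemma permR_eqe_refl E : permR eqe E E.
Proof. by apply: permR_refl => x _; split=> //; apply: teq_refl. Qed.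

Lemma nd_perm I E X A I' E' : nd I E X A -> perm_eq I I' -> Permutation E E' ->
  nd I' E' X A.
Proof.
move=> d pI pE; apply: (nd_iso d pI _ (teq_refl A) (wfs_perm (nd_wfs d) pI pE)).
exact: permR_Permr pE (permR_eqe_refl E).
Qed.

(** The external names of the left sequent form the attachment of the cut edge and hence are nodes
    of the right one; only [J] is new. *)
Lemma wfs_cut J F a A I E0 E X B A' :
  wfs J F a A -> wfs I E0 X B -> Permutation E0 ((A', a) :: E) ->
  uniq ((I ++ J) ++ X) -> wfs (I ++ J) (E ++ F) X B.
Proof.
move=> [_ wF _ _] [_ wE wB sX] p u.
have wE' := fun t b h => wE t b (Permutation_in _ (Permutation_sym p) h).
have [_ _ _ suba] := wE' _ _ (or_introl erefl).
split=> // t b /In_cat[h|h].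
  have [? ? ? sub] := wE' _ _ (or_intror h); split=> // x /sub; rewrite !mem_cat.
  by case/orP=> ->; rewrite ?orbT.
have [? ? ? sub] := wF _ _ h; split=> // x /sub; rewrite !mem_cat.
by case/orP=> [->|/suba]; rewrite ?orbT // mem_cat => /orP[]->; rewrite ?orbT.
Qed.

Lemma perm_nodes L (G : hgraph L) : wf_struct G ->
  perm_eq (iota 0 (nV G)) (intn G ++ ext G).
Proof.
move=> [_ [/allP wx ux]]; apply: uniq_perm; first exact: iota_uniq.
  rewrite cat_uniq filter_uniq ?iota_uniq // ux andbT; apply/hasPn => x xx.
  by rewrite mem_filter negb_and negbK xx.
move=> x; rewrite mem_cat mem_filter !mem_iota add0n /=.
by case: (boolP (x \in ext G)) => [/wx->|]; rewrite ?orbT ?orbF.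
Qed.

Lemma count_nodes L (G : hgraph L) r (x : nat) : wf_struct G ->
  count_mem x (map r (iota 0 (nV G))) =
  count_mem x (map r (intn G)) + count_mem x (map r (ext G)).
Proof.
by move=> wG; have /permP-> := perm_map r (perm_nodes wG); rewrite map_cat count_cat.
Qed.

Lemma leq_count_sub (s t : seq nat) x : uniq s -> {subset s <= t} ->
  count_mem x s <= count_mem x t.
Proof. by move=> us st; apply: leq_uniq_count. Qed.

Lemma map_inj_on_uniq n r a : inj_on n r -> all (fun v => v < n) a -> uniq a ->
  uniq (map r a).
Proof.
by move=> ri /allP an ua; rewrite map_inj_in_uniq // => u v /an ltu /an ltv; apply: ri.
Qed.

(** The attachment nodes of an edge are distinct nodes of [G], expressed as an inequality that
    [count_lia] can use. *)
Lemma count_att L (G : hgraph L) r t b (x : nat) : wf_struct G -> inj_on (nV G) r ->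
  List.In (t, b) (edges G) ->
  count_mem x (map r b) <=
  count_mem x (map r (intn G)) + count_mem x (map r (ext G)).
Proof.
move=> wG ri Gb; rewrite -count_nodes //; have [wb ub] := (wG).1 _ Gb.
apply: leq_count_sub; first exact: map_inj_on_uniq wb ub.
by move=> y /mapP[v /(allP wb) ltv ->]; apply: map_f; rewrite mem_iota.
Qed.

Lemma uniq_map_iota n r : inj_on n r -> uniq (map r (iota 0 n)).
Proof.
move=> ri; apply: (map_inj_on_uniq ri); rewrite ?iota_uniq //.
by apply/allP=> v; rewrite mem_iota.
Qed.

Lemma In_rn L r (l : seq (L * seq nat)) t a : List.In (t, a) (rn r l) ->
  exists2 b, List.In (t, b) l & a = map r b.
Proof. by elim: l => //= -[t' b] l IH [[-> <-]|/IH[c]]; [exists b; tauto | exists c; tauto]. Qed.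

Lemma In_somes L (l : seq (option L * seq nat)) t a :
  List.In (t, a) (somes l) -> List.In (Some t, a) l.
Proof. by elim: l => //= -[[t'|] b] l IH /=; [case=> [[-> ->]|/IH] | move/IH]; auto. Qed.

Ltac ucount := repeat (match goal with H : is_true (uniq _) |- _ =>
    move/uniq_countP in H end).

Ltac count_lia := rewrite ?count_cat;
  repeat change (Equality.sort Datatypes_nat__canonical__eqtype_Equality) with nat; lia.

(** The induction on the right derivation, with the left one fixed. The two long hypotheses stand
    for the principal cuts, in which the last rule on the right introduces the cut edge. They are
    left open here because their solution depends on the last rule on the left: [cut_left] refutes
    one of them and proves the other by smaller cuts. *)
Lemma cut_right J F a A :
  nd J F a A ->
  (forall I E X B N D r a0 J1 F1,
     List.In (None, a0) (edges D) -> inj_on (nV D) r ->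
     nd I ((N, map r (ext D)) :: E) X B -> nds (rn r (edges D)) J1 F1 ->
     wfs (I ++ map r (intn D) ++ J1) ((Div N D, map r a0) :: E ++ F1) X B ->
     map r a0 = a -> teq A (Div N D) ->
     uniq (((I ++ map r (intn D) ++ J1) ++ J) ++ X) ->
     nd ((I ++ map r (intn D) ++ J1) ++ J) ((E ++ F1) ++ F) X B) ->
  (forall I E X B M,
     (forall r, inj_on (nV M) r -> map r (ext M) = a ->
        uniq ((I ++ map r (intn M)) ++ X) ->
        nd (I ++ map r (intn M)) (rn r (edges M) ++ E) X B) ->
     wfs I ((Times M, a) :: E) X B -> teq A (Times M) ->
     uniq ((I ++ J) ++ X) -> nd (I ++ J) (E ++ F) X B) ->
  forall I E0 X B, nd I E0 X B ->
  forall E A', Permutation E0 ((A', a) :: E) -> teq A A' ->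
  uniq ((I ++ J) ++ X) -> nd (I ++ J) (E ++ F) X B.
Proof.
move=> dJ KD KT I0 E0 X0 B0 d0.
have wJ := nd_wfs dJ; have [_ _ wA _] := wJ.
(* The cut falls into one premise of the list, whose external string is its [b]. Freshness there
   requires [J] to avoid [b] as well, which is the last condition, since [nds] does not relate the
   attachments [b] to the surrounding sequent. *)
pose Q T J1 F1 := forall F' A', Permutation F1 ((A', a) :: F') -> teq A A' ->
  uniq (J1 ++ J) -> (forall t b, List.In (Some t, b) T -> uniq (J ++ b)) ->
  exists J' F'', [/\ nds T J' F'', perm_eq J' (J1 ++ J) & Permutation F'' (F' ++ F)].
move: I0 E0 X0 B0 d0.
apply: (@nd_mut _ Q); rewrite {}/Q.
- move=> p n b ub sb E A' pE tA u; have /= := Permutation_size pE.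
  case: E pE => // pE _; have [eA eb] := Permutation_length_1_inv pE; subst => /=.
  apply: (nd_iso dJ) => //; first exact: permR_eqe_refl.
  by case: wJ => ? ? ? ?; split=> //; constructor.
- move=> I E0 X B I' E0' B' d IH pI pE tB w E A' p tA u.
  (* The label of the cut edge may have been a different isomorphic type [A''] before this rule;
     this is why the label is related to [A] by [teq] only. *)
  have [[A'' a''] [E1 [pE1 [/= tA'' ea''] pE1']]] := permR_consr (permR_Permr p pE).
  subst a''.
  have wA' : wf_tp A''.
    have [_ wE _ _] := nd_wfs d.
    by have [] := wE _ _ (Permutation_in _ (Permutation_sym pE1) (or_introl erefl)).
  have /(IH _ _ pE1) : teq A A''.
    apply: teq_trans tA _; exact: teq_sym tA''.
  have pu : perm_eq ((I ++ J) ++ X) ((I' ++ J) ++ X) by rewrite !perm_cat2r.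
  rewrite (perm_uniq pu) => /(_ u) d'.
  apply: (nd_iso d') => //; first by rewrite perm_cat2r.
    by apply: permR_cat => //; apply: permR_eqe_refl.
  exact: wfs_cut wJ w p u.
- move=> I E1 X B N D r a0 J1 F1 Da0 ri d IH ds IHs w E A' p tA u.
  have [[[eA ea] pE]|[E' pE' pE]] := Perm_cons_cons p.
    subst A'; apply: nd_perm (KD _ _ _ _ _ _ _ _ _ _ Da0 ri d ds w (esym ea) tA u) _ _ => //.
    exact: Perm_catr.
  have wD : wf_struct D.
    by have [_ wE _ _] := w; have [] := wE _ _ (or_introl erefl); inversion 1.
  have wconc := wfs_cut wJ w p u.
  have [[E2 pE2 pE2']|[F2 pF2 pF2']] := Perm_cons_cat pE'.
  + have d' : nd (I ++ J) ((N, map r (ext D)) :: (E2 ++ F)) X B.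
      apply: nd_perm (IH ((N, map r (ext D)) :: E2) A' _ tA _) _ _ => //.
        apply: Permutation_trans (perm_skip _ pE2) _; exact: perm_swap.
      by ucount; apply/uniq_countP => x; have := u x; count_lia.
    have pI : perm_eq ((I ++ map r (intn D) ++ J1) ++ J) ((I ++ J) ++ map r (intn D) ++ J1).
      by apply: eq_count_perm => x; count_lia.
    have pEF : Permutation (E ++ F) ((Div N D, map r a0) :: (E2 ++ F) ++ F1).
      apply: Permutation_trans (Perm_catr _ pE) _.
      apply: Permutation_trans (perm_skip _ (Perm_catr _ pE2')) _.
      by perm_cat.
    apply: nd_perm (nd_divL Da0 ri d' ds (wfs_perm wconc pI pEF)) _ _.
      by rewrite perm_sym.
    exact: Permutation_sym.
  (* Here the cut falls into a side premise, attached to nodes of [D]. Internal nodes of [D] occur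
     in the conclusion, and external ones are attachment nodes of the [N]-edge and thus lie in
     [I ++ X], so [J] avoids them all. *)
  + have [_ wE _ _] := nd_wfs d; have [_ _ uN subN] := wE _ _ (or_introl erefl).
    have uT t b : List.In (Some t, b) (rn r (edges D)) -> uniq (J ++ b).
      move=> h; have [b0 Db0 ->] := In_rn h; have [uJ _ _ _] := wJ.
      have [wb ub] := (wD).1 _ Db0; have {}ub := map_inj_on_uniq ri wb ub.
      have leN := fun x => leq_count_sub x uN subN.
      ucount; apply/uniq_countP => x; move: (u x) (uJ x) (ub x) (leN x).
      by have := count_att x wD ri Db0; count_lia.
    have [|J' [F' [ds' pJ' pF']]] := IHs _ _ pF2 tA _ uT.
      by ucount; apply/uniq_countP => x; have := u x; count_lia.
    have pI : perm_eq ((I ++ map r (intn D) ++ J1) ++ J) (I ++ map r (intn D) ++ J').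
      apply: eq_count_perm => x; have /permP/(_ (pred1 x)) := pJ'.
      by count_lia.
    have pEF : Permutation (E ++ F) ((Div N D, map r a0) :: E1 ++ F').
      apply: Permutation_trans (Perm_catr _ pE) _.
      apply: Permutation_trans (perm_skip _ (Perm_catr _ pF2')) _.
      apply: Permutation_trans (perm_skip _ (Perm_catl _ (Permutation_sym pF'))).
      by perm_cat.
    apply: nd_perm (nd_divL Da0 ri d ds' (wfs_perm wconc pI pEF)) _ _.
      by rewrite perm_sym.
    exact: Permutation_sym.
- move=> I E1 X N D a0 Da0 d IH w E A' p tA u.
  apply: (nd_divR Da0); last exact: wfs_cut wJ w p u.
  have wD : wf_struct D by have [_ _ wB _] := w; inversion wB.
  move=> r ri ea0 ur.
  apply: nd_perm (IH r ri ea0 _ (somes (rn r (edges D)) ++ E) _ _ tA _) _ _.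
  + by ucount; apply/uniq_countP => x; have := ur x; count_lia.
  + apply: Permutation_trans (Perm_catl _ p) _; exact: Perm_cat_cons.
  + ucount; apply/uniq_countP => x; have := ur x.
    by have := count_nodes r x wD; count_lia.
  + by rewrite catA.
  + by perm_cat.
- move=> I E1 X B M b d IH w E A' p tA u.
  have [[[eA ea] pE]|[E' pE' pE]] := Perm_cons_cons p.
    subst; apply: nd_perm (KT _ _ _ _ _ d w tA u) _ _ => //.
    exact: Perm_catr.
  have wconc := wfs_cut wJ w p u.
  have pEF : Permutation (E ++ F) ((Times M, b) :: (E' ++ F)).
    by apply: Permutation_trans (Perm_catr _ pE) _; perm_cat.
  apply: nd_perm (nd_timesL _ (wfs_perm wconc (perm_refl _) pEF)) _ _ => //; last first.
    exact: Permutation_sym.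
  move=> r ri eb ur.
  apply: nd_perm (IH r ri eb _ (rn r (edges M) ++ E') _ _ tA _) _ _.
  + by ucount; apply/uniq_countP => x; have := ur x; count_lia.
  + apply: Permutation_trans (Perm_catl _ pE') _; exact: Perm_cat_cons.
  + ucount; apply/uniq_countP => x; have := ur x.
    by count_lia.
  + by apply: eq_count_perm => x; count_lia.
  + by perm_cat.
- move=> M r J1 F1 ri ds IHs w E A' p tA u.
  have wM : wf_struct M by have [_ _ wB _] := w; inversion wB.
  have wconc := wfs_cut wJ w p u.
  have uT t b :
      List.In (Some t, b) (rn r [seq (Some x.1, x.2) | x <- edges M]) -> uniq (J ++ b).
    move=> h; have [b0 Db0 ->] := In_rn h; have [uJ _ _ _] := wJ.
    have {}Db0 : List.In (t, b0) (edges M).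
      by elim: (edges M) Db0 => //= -[t' c] l IHl [[-> ->]|/IHl]; auto.
    have [wb ub] := (wM).1 _ Db0; have {}ub := map_inj_on_uniq ri wb ub.
    ucount; apply/uniq_countP => x; move: (u x) (uJ x) (ub x).
    by have := count_att x wM ri Db0; count_lia.
  have [|J' [F' [ds' pJ' pF']]] := IHs _ _ p tA _ uT.
    by ucount; apply/uniq_countP => x; have := u x; count_lia.
  have pI : perm_eq ((map r (intn M) ++ J1) ++ J) (map r (intn M) ++ J').
    apply: eq_count_perm => x; have /permP/(_ (pred1 x)) := pJ'.
    by count_lia.
  have pEF := Permutation_sym pF'.
  apply: nd_perm (nd_timesR ri ds' (wfs_perm wconc pI pEF)) _ pF'.
  by rewrite perm_sym.
- by move=> F' A' p; have := Permutation_size p.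
- move=> b T J1 F1 ds IHs F' A' p tA u uT.
  have uT' t c : List.In (Some t, c) T -> uniq (J ++ c) by move=> Tc; apply: (uT t); right.
  have [J' [F'' [? ? ?]]] := IHs _ _ p tA u uT'.
  by exists J', F''; split=> //; constructor.
- move=> t b T J1 F1 J2 F2 d IH ds IHs F' A' p tA u uT.
  have [[F3 pF3 pF']|[F3 pF3 pF']] := Perm_cons_cat p.
  + have [uJ1 _ _ _] := nd_wfs d; have := uT _ _ (or_introl erefl) => ub.
    have d' : nd (J1 ++ J) (F3 ++ F) b t.
      apply: (IH _ _ pF3 tA).
      ucount; apply/uniq_countP => x; move: (u x) (uJ1 x) (ub x).
      by count_lia.
    exists ((J1 ++ J) ++ J2), ((F3 ++ F) ++ F2); split; first by constructor.
      by apply: eq_count_perm => x; count_lia.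
    apply: Permutation_trans (Perm_catr _ (Permutation_sym pF')).
    by perm_cat.
  + have uT' t' c : List.In (Some t', c) T -> uniq (J ++ c).
      by move=> Tc; apply: (uT t'); right.
    have [|J' [F'' [ds' pJ' pF'']]] := IHs _ _ pF3 tA _ uT'.
      by ucount; apply/uniq_countP => x; have := u x; count_lia.
    exists (J1 ++ J'), (F1 ++ F''); split; first by constructor.
      apply: eq_count_perm => x; have /permP/(_ (pred1 x)) := pJ'.
      by count_lia.
    apply: Permutation_trans (Perm_catr _ (Permutation_sym pF')).
    apply: Permutation_trans (Perm_catl _ pF'') _.
    by perm_cat.
Qed.

(** * Cut elimination in the named calculus *)

Definition cuttable A := forall J F a, nd J F a A ->
  forall I E0 X B, nd I E0 X B ->
  forall E A', Permutation E0 ((A', a) :: E) -> teq A A' ->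
  uniq ((I ++ J) ++ X) -> nd (I ++ J) (E ++ F) X B.

(* Quantifying over all isomorphic copies makes cut_ok invariant under teq, so
   that the induction on the cut type is structural. *)
Definition cut_ok A := forall A', teq A A' -> cuttable A'.

(** The induction hypothesis on the cut type, as a property of an arbitrary type: the induction on
    the left derivation can then carry it across [nd_iso], where the type changes up to [teq]. *)
Definition subtypes_ok A :=
  match A with
  | Prim _ _ => True
  | Div N D => cut_ok N /\ (forall t b, List.In (Some t, b) (edges D) -> cut_ok t)
  | Times M => forall t b, List.In (t, b) (edges M) -> cut_ok t
  end.

Lemma cut_ok_teq A A' : teq A A' -> cut_ok A -> cut_ok A'.
Proof. by move=> tA okA A'' tA'; apply: okA; apply: teq_trans tA'. Qed.

Lemma subtypes_ok_teq A A' : teq A A' -> subtypes_ok A -> subtypes_ok A'.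
Proof.
case: A => [p n|N D|M]; first by move=> H; inversion H.
- move=> /teq_DivE[N' [D' [phi [-> tN [_ _ _ _ pD]]]]] [okN okD].
  split=> [|t b D'b]; first exact: cut_ok_teq okN.
  have [[x c] Dx /= [[[_ //]|[u [u' [ex [->] tu]]]] _]] := permR_In pD D'b.
  by rewrite {}ex in Dx; apply: cut_ok_teq tu (okD _ _ Dx).
- move=> /teq_TimesE[M' [phi [-> [_ _ _ _ pM]]]] okM t b M'b.
  have [[x c] Mx /= [tx _]] := permR_In pM M'b.
  by apply: cut_ok_teq tx (okM _ _ Mx).
Qed.

(** The simultaneous replacement of the edges in [T], carried out as a sequence of single cuts. *)
Lemma cut_nds T J F : nds T J F ->
  (forall t b, List.In (Some t, b) T -> cuttable t) ->
  forall I E X B, nd I (somes T ++ E) X B -> uniq ((I ++ J) ++ X) ->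
  nd (I ++ J) (E ++ F) X B.
Proof.
elim=> {T J F} [_ I E X B d _|b T J F _ IH okT I E X B d u|].
- by rewrite !cats0.
- by apply: IH => // t c Tc; apply: (okT t c); right.
- move=> t b T J1 F1 J F d1 _ IH okT I E X B d u.
  have d' : nd (I ++ J1) (somes T ++ (E ++ F1)) X B.
    rewrite catA; apply: (okT t b (or_introl erefl) _ _ _ d1 _ _ _ _ d _ _ (Permutation_refl _) (teq_refl _)).
    by ucount; apply/uniq_countP => x; have := u x; count_lia.
  rewrite !catA; apply: IH d' _ => [t' c Tc|]; first by apply: (okT t' c); right.
  by rewrite -[(I ++ J1) ++ J]catA.
Qed.

(** The bijection of all nodes matches external nodes with external ones; cancelling these leaves
    the internal nodes. *)
Lemma isoR_intn L L' (R : L -> L' -> Prop) phi G G' : isoR phi R G G' ->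
  wf_struct G -> wf_struct G' -> perm_eq (map phi (intn G)) (intn G').
Proof.
move=> iG wG wG'; have [_ _ _ ext1 _] := iG.
rewrite -(perm_cat2r (ext G')) {1}ext1 -map_cat.
apply: perm_trans (perm_nodes wG'); apply: perm_trans (isoR_nodes iG).
by apply: perm_map; rewrite perm_sym; apply: perm_nodes.
Qed.

Lemma isoR_rn L L' (R : L -> L' -> Prop) phi r G G' : isoR phi R G G' ->
  permR (fun x y => R x.1 y.1 /\ y.2 = x.2)
    (rn (r \o phi) (edges G)) (rn r (edges G')).
Proof.
case=> _ _ _ _ pG; apply: permR_map; apply: permR_impl pG _ => x y _ _ /= [Rxy ->].
by rewrite -map_comp.
Qed.

Lemma isoR_inj L L' (R : L -> L' -> Prop) phi r G G' : isoR phi R G G' ->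
  inj_on (nV G') r -> inj_on (nV G) (r \o phi).
Proof.
case=> _ lt1 inj1 _ _ ri u v ltu ltv /ri e.
by apply: inj1 => //; apply: e; apply: lt1.
Qed.

Lemma Permutation_somes L (l l' : seq (option L * seq nat)) :
  Permutation l l' -> Permutation (somes l) (somes l').
Proof.
elim=> {l l'} //= [[[t|] a] l l' _ p|[[t|] a] [[u|] b] l|l1 l2 l3 _ p _ q] //=.
- exact: perm_skip.
- exact: perm_swap.
- exact: Permutation_trans q.
Qed.

Lemma permR_somes l l' :
  permR (fun x y => optR teq x.1 y.1 /\ y.2 = x.2) l l' ->
  permR eqe (somes l) (somes l').
Proof.
case=> m Rl /Permutation_somes pm; exists (somes m) => //.
elim: Rl {pm} => {l m} //= -[x a] [y b] l m /= [[[-> ->]|[t [t' [-> -> tt]]]] e] _ IH //=.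
by constructor.
Qed.

Lemma dollar_uniq L (l : seq (option L * seq nat)) a b :
  count (fun x => ~~ isSome x.1) l = 1 ->
  List.In (None, a) l -> List.In (None, b) l -> a = b.
Proof.
have H c : List.In (None, c) l -> [seq x <- l | ~~ isSome x.1] = [:: (None, c)] \/
    1 < count (fun x => ~~ isSome x.1) l.
  rewrite -size_filter => lc.
  have {lc}: List.In (None, c) [seq x <- l | ~~ isSome x.1].
    by elim: l lc => //= -[[t|] d] l IH /= [E|/IH]; auto; discriminate.
  case: filter => [|x [|y s]] //= lc; last by right.
  by left; case: lc => [->|].
move=> c1 /H[ea|]; last by rewrite c1.
move=> /H[|]; last by rewrite c1.
by rewrite ea => -[].
Qed.

Lemma wfs_inst L (G : hgraph L) r t a : wf_struct G -> inj_on (nV G) r ->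
  List.In (t, a) (rn r (edges G)) ->
  [/\ exists2 b, List.In (t, b) (edges G) & size a = size b, uniq a &
      {subset a <= map r (intn G) ++ map r (ext G)}].
Proof.
move=> wG ri h; have [b Gb ->] := In_rn h; have [wb ub] := (wG).1 _ Gb; split.
- by exists b; rewrite ?size_map.
- exact: map_inj_on_uniq wb ub.
- move=> x /mapP[v /(allP wb) ltv ->]; rewrite -map_cat map_f //.
  by rewrite -(perm_mem (perm_nodes wG)) mem_iota.
Qed.

(** A left rule at the end of the left derivation commutes with the cut, and an axiom makes the cut
    void. A right rule has just introduced the cut type, so [cut_right] takes over, and its
    principal case needs cuts on immediate subtypes only. *)
Lemma cut_left J F a A : nd J F a A -> subtypes_ok A ->
  forall I E0 X B, nd I E0 X B ->
  forall E A', Permutation E0 ((A', a) :: E) -> teq A A' ->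
  uniq ((I ++ J) ++ X) -> nd (I ++ J) (E ++ F) X B.
Proof.
move: J F a A; apply: nd_ind.
- move=> p n b ub sb _ I E0 X B d E A' p0 tA u; rewrite cats0.
  inversion tA; subst; apply: nd_perm d _ _ => //.
  by apply: Permutation_trans p0 _; perm_cat.
- move=> J F a A J' F' A' d IH pJ pF tA w okA I E0 X B dB E A'' p tA' u.
  have [_ _ wA _] := nd_wfs d.
  have okA0 := subtypes_ok_teq (teq_sym wA tA) okA.
  have d' := IH okA0 _ _ _ _ dB _ _ p (teq_trans tA tA').
  have pu : perm_eq ((I ++ J) ++ X) ((I ++ J') ++ X).
    by rewrite perm_cat2r perm_cat2l.
  rewrite (perm_uniq pu) in d'; apply: (nd_iso (d' u)) (teq_refl _) _.
  + by rewrite perm_cat2l.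
  + by apply: permR_cat => //; apply: permR_eqe_refl.
  + exact: wfs_cut w (nd_wfs dB) p u.
- move=> J E1 a A N D r a0 J1 F1 Da0 ri d IH ds w okA I E0 X B dB E A' p tA u.
  have wconc := wfs_cut w (nd_wfs dB) p u.
  have d' : nd (I ++ J) ((N, map r (ext D)) :: E ++ E1) X B.
    apply: nd_perm (IH okA _ _ _ _ dB _ _ p tA _) _ _ => //; last by perm_cat.
    by ucount; apply/uniq_countP => x; have := u x; count_lia.
  have pI : perm_eq (I ++ J ++ map r (intn D) ++ J1) ((I ++ J) ++ map r (intn D) ++ J1).
    by rewrite catA.
  have pEF : Permutation (E ++ (Div N D, map r a0) :: E1 ++ F1)
    ((Div N D, map r a0) :: (E ++ E1) ++ F1) by perm_cat.
  apply: nd_perm (nd_divL Da0 ri d' ds (wfs_perm wconc pI pEF)) _ _.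
    by rewrite perm_sym.
  exact: Permutation_sym.
- move=> J F a N D a0 Da0 dP _ w [okN okD] I E0 X B dB E A' p tA u.
  apply: (cut_right (nd_divR Da0 dP w) _ _ dB p tA u); last first.
    by move=> ? ? ? ? ? ? ? H; inversion H.
  clear I E0 X B dB E A' p tA u; move=> I E X B N' D' r a0' J1 F1 D'a0 ri d ds wR ea tA u.
  move: (tA) => /teq_DivE[N0 [D0 [phi [[<- <-] tN iD]]]] {N0 D0}.
  have [_ _ wND _] := w; have [_ wE _ _] := wR.
  have [wND' _ _ _] := wE _ _ (or_introl erefl).
  inversion wND as [|? ? _ wD _ _ _|]; subst.
  inversion wND' as [|? ? wN' wD' c1 wl sN'|]; subst.
  have [_ wEd _ _] := nd_wfs d; have [_ _ uN subN] := wEd _ _ (or_introl erefl).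
  have leN := fun x => leq_count_sub x uN subN.
  have nD' := fun x => count_nodes r x wD'.
  (* [phi] maps the [$]-edge of [D] to an edge labeled [$], and [D'] has only one; therefore
     [r \o phi] is an admissible instance for the premise of (->÷). *)
  have ea0 : map (r \o phi) a0 = map r a0'.
    have [_ _ _ _ pD] := iD.
    have [y D'y [Rn /= ey]] := permR_In (permR_sym pD) Da0.
    case: y D'y Rn ey => y b D'y /= [[_ ey]|[? [? [? ? _]]]] // eb.
    by subst; rewrite (dollar_uniq c1 D'a0 D'y) -map_comp.
  have := dP _ (isoR_inj iD ri) ea0.
  have [_ _ _ eext _] := iD; rewrite (map_comp r phi (ext D)) -eext => {}dP.
  have uJD : uniq (J ++ map (r \o phi) (iota 0 (nV D))).
    have pp : perm_eq (J ++ map (r \o phi) (iota 0 (nV D))) (J ++ map r (iota 0 (nV D'))).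
      by rewrite perm_cat2l map_comp; apply: perm_map; apply: isoR_nodes iD.
    rewrite (perm_uniq pp).
    by ucount; apply/uniq_countP => x; move: (u x) (leN x) (nD' x) (uN x); count_lia.
  have okD' t b : List.In (Some t, b) (rn r (edges D')) -> cuttable t.
    move=> h; have [b' D'b _] := In_rn h; have [_ _ _ _ pD] := iD.
    have [[x c] Dx /= [[[_ //]|[t0 [t1 [ex [->] tt]]]] _]] := permR_In pD D'b.
    by rewrite ex in Dx; apply: (okD _ _ Dx).
  have wd : wfs (map r (intn D') ++ J) (somes (rn r (edges D')) ++ F) (map r (ext D')) N'.
    have [_ wF _ _] := w; split; last by rewrite size_map.
    + by ucount; apply/uniq_countP => x; move: (u x) (leN x) (uN x); count_lia.
    + move=> t b /In_cat[h|h].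
        have {}h := In_somes h.
        have [[b' D'b eb] ub sub] := wfs_inst wD' ri h.
        have [wt st] := wl _ _ D'b; split; rewrite ?eb // => x /sub.
        by rewrite !mem_cat => /orP[]->; rewrite ?orbT.
      have [wt st ub sub] := wF _ _ h; split=> // x /sub; rewrite !mem_cat.
      case/orP=> [->|]; rewrite ?orbT // => /mapP[v va ->].
      have [/allP/(_ _ va) /= ltv _] := (wD').1 _ D'a0.
      have: v \in intn D' ++ ext D' by rewrite -(perm_mem (perm_nodes wD')) mem_iota.
      by rewrite mem_cat => /orP[]/(map_f r)->; rewrite ?orbT.
    + exact: wN'.
  have d1 : nd (map r (intn D') ++ J) (somes (rn r (edges D')) ++ F) (map r (ext D')) N'.
    apply: (nd_iso (dP uJD) _ _ tN wd).
      by rewrite perm_cat2r map_comp; apply: perm_map; apply: isoR_intn iD wD wD'.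
    apply: permR_cat; last exact: permR_eqe_refl.
    by apply: permR_somes; apply: isoR_rn iD.
  (* Cutting the instance against the side premises of (÷->) leaves a derivation of [N'] whose
     external names are [map r (ext D')]. This is the attachment of the [N']-edge in [d], so a
     single cut on [N'] remains. *)
  have d2 := cut_nds ds okD' d1.
  have {}d2 : nd ((map r (intn D') ++ J) ++ J1) (F ++ F1) (map r (ext D')) N'.
    apply: d2.
    by ucount; apply/uniq_countP => x; move: (u x) (leN x) (uN x); count_lia.
  apply: nd_perm (okN _ tN _ _ _ d2 _ _ _ _ d _ _ (Permutation_refl _) (teq_refl _) _) _ _.
  + by ucount; apply/uniq_countP => x; move: (u x); count_lia.
  + by apply: eq_count_perm => x; count_lia.
  + by perm_cat.
- move=> J E1 a A M b d IH w okA I E0 X B dB E A' p tA u.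
  have wconc := wfs_cut w (nd_wfs dB) p u.
  have pEF : Permutation (E ++ (Times M, b) :: E1) ((Times M, b) :: (E ++ E1)) by perm_cat.
  apply: nd_perm (nd_timesL _ (wfs_perm wconc (perm_refl _) pEF)) _ _ => //; last first.
    exact: Permutation_sym.
  (* The premise wants names fresh for [J ++ a]. Since [a] is the attachment of the cut edge and
     lies in [I ++ X], an instance fresh for the whole conclusion qualifies. *)
  have [_ wE _ _] := nd_wfs dB.
  have [_ _ ua suba] := wE _ _ (Permutation_in _ (Permutation_sym p) (or_introl erefl)).
  have lea := fun x => leq_count_sub x ua suba.
  have [uJ _ _ _] := w.
  move=> r ri eb ur.
  apply: nd_perm (IH r ri eb _ okA _ _ _ _ dB _ _ p tA _) _ _.
  + by ucount; apply/uniq_countP => x; move: (ur x) (lea x) (uJ x); count_lia.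
  + by ucount; apply/uniq_countP => x; move: (ur x); count_lia.
  + by apply: eq_count_perm => x; count_lia.
  + by perm_cat.
- move=> M r J F ri ds w okM I E0 X B dB E A' p tA u.
  apply: (cut_right (nd_timesR ri ds w) _ _ dB p tA u).
    by move=> ? ? ? ? ? ? ? ? ? ? _ _ _ _ _ _ H; inversion H.
  clear I E0 X B dB E A' p tA u; move=> I E X B M' d wR tA u.
  have [_ wF wMM _] := w; have [_ wE _ sX] := wR.
  have [wMM' _ _ subM] := wE _ _ (or_introl erefl).
  (* The quantified instances are now those of [M'], while [r] names [M]; the isomorphism must lead
     from [M'] to [M]. *)
  move: (teq_sym wMM tA) => /teq_TimesE[M0 [phi [[<-] iM]]] {M0}.
  inversion wMM as [| |? wM wl]; subst.
  inversion wMM' as [| |? wM' wl']; subst.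
  have [_ _ _ eext _] := iM.
  have pI : perm_eq (map (r \o phi) (intn M')) (map r (intn M)).
    by rewrite map_comp; apply: perm_map; apply: isoR_intn iM wM' wM.
  have u1 : uniq ((I ++ map (r \o phi) (intn M')) ++ X).
    rewrite (perm_uniq (_ : perm_eq _ ((I ++ map r (intn M)) ++ X))); last first.
      by rewrite perm_cat2r perm_cat2l.
    by ucount; apply/uniq_countP => x; move: (u x); count_lia.
  have {}d : nd (I ++ map (r \o phi) (intn M')) (rn (r \o phi) (edges M') ++ E) X B.
    by apply: d u1; [apply: isoR_inj iM ri | rewrite eext -map_comp].
  have d1 : nd (I ++ map r (intn M)) (rn r (edges M) ++ E) X B.
    apply: (nd_iso d _ _ (teq_refl _)).
    + by rewrite perm_cat2l.
    + apply: permR_cat; last exact: permR_eqe_refl.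
      exact: isoR_rn iM.
    + have [_ wE' wB sX'] := nd_wfs d; split=> //.
        by ucount; apply/uniq_countP => x; move: (u x); count_lia.
      move=> t b /In_cat[h|h].
        have [[b' Mb eb] ub sub] := wfs_inst wM ri h.
        have [wt st] := wl _ _ Mb; split; rewrite ?eb // => x /sub.
        rewrite !mem_cat => /orP[->|xx]; first by rewrite ?orbT.
        by have := subM x xx; rewrite mem_cat => /orP[]->; rewrite ?orbT.
      have [wt st ub sub] := wE _ _ (or_intror h); split=> // x /sub.
      by rewrite !mem_cat => /orP[]->; rewrite ?orbT.
  have okM' t b : List.In (Some t, b) (rn r [seq (Some x.1, x.2) | x <- edges M]) -> cuttable t.
    move=> h; have [b' h' _] := In_rn h; apply: (okM t b' _ _ (teq_refl t)).
    by elim: (edges M) h' => //= -[t' c] l IHl [[-> ->]|/IHl]; auto.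
  have e1 : somes (rn r [seq (Some x.1, x.2) | x <- edges M]) = rn r (edges M).
    by elim: (edges M) => //= x l ->.
  have d2 := cut_nds ds okM'; rewrite e1 in d2.
  apply: nd_perm (d2 _ _ _ _ d1 _) _ _ => //.
  + by ucount; apply/uniq_countP => x; move: (u x); count_lia.
  + by rewrite catA.
Qed.

Lemma nd_cut A : cut_ok A.
Proof.
elim/tp_nested_ind: A => [p n|N D okN okD|M okM] A' tA J F a d;
  by apply: (cut_left d); apply: subtypes_ok_teq tA _.
Qed.

(** * Namings of a replacement graph *)

(** The flattened indexed map in the definition of [subst], as a recursion carrying the position [k]
    of the head, which allows edge lists to be split and shifted. *)
Fixpoint pieces A B (h : nat -> A -> seq B) k (l : seq A) :=
  if l is x :: l' then h k x ++ pieces h k.+1 l' else [::].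

Section Pieces.
Variables (A B : Type).
Implicit Types (h : nat -> A -> seq B) (l : seq A).

Lemma pieces_zip h k l :
  flatten [seq h p.1 p.2 | p <- zip (iota k (size l)) l] = pieces h k l.
Proof. by elim: l k => //= x l IH k; rewrite IH. Qed.

Lemma pieces_cat h k l1 l2 :
  pieces h k (l1 ++ l2) = pieces h k l1 ++ pieces h (k + size l1) l2.
Proof.
elim: l1 k => [|x l1 IH] k /=; first by rewrite addn0.
by rewrite IH -catA addSnnS.
Qed.

Lemma eq_pieces h h' k k' l :
  (forall i x, onth l i = Some x -> h (k + i) x = h' (k' + i) x) ->
  pieces h k l = pieces h' k' l.
Proof.
elim: l k k' => //= x l IH k k' e; congr (_ ++ _).
  by have := e 0 x erefl; rewrite !addn0.
by apply: IH => i y li; rewrite !addSnnS; apply: e.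
Qed.

Lemma map_pieces C (g : B -> C) h k l :
  map g (pieces h k l) = pieces (fun i x => map g (h i x)) k l.
Proof. by elim: l k => //= x l IH k; rewrite map_cat IH. Qed.

Lemma pieces_map C (g : C -> A) h k (l : seq C) :
  pieces h k (map g l) = pieces (fun i x => h i (g x)) k l.
Proof. by elim: l k => //= x l IH k; rewrite IH. Qed.

Lemma pieces_nil h k l : (forall i x, onth l i = Some x -> h (k + i) x = [::]) ->
  pieces h k l = [::].
Proof.
elim: l k => //= x l IH k e; have := e 0 x erefl; rewrite addn0 => ->.
by apply: IH => i y li; rewrite addSnnS; apply: e.
Qed.

Lemma size_pieces h k l (g : nat -> nat) :
  (forall i x, onth l i = Some x -> size (h (k + i) x) = g (k + i)) ->
  size (pieces h k l) = sumn [seq g j | j <- iota k (size l)].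
Proof.
elim: l k => //= x l IH k e; rewrite size_cat.
have := e 0 x erefl; rewrite addn0 => ->; congr (_ + _).
by apply: IH => i y li; rewrite addSnnS; apply: e.
Qed.

Lemma nth_pieces d h k l (g : nat -> nat) i x t :
  (forall i x, onth l i = Some x -> size (h (k + i) x) = g (k + i)) ->
  onth l i = Some x -> t < g (k + i) ->
  nth d (pieces h k l) (sumn [seq g j | j <- iota k i] + t) = nth d (h (k + i) x) t.
Proof.
elim: l k i => [|y l IH] k [|i] //= e.
  case=> <-; have := e 0 y erefl; rewrite addn0 add0n => <- ltt.
  by rewrite nth_cat ltt.
have e0 := e 0 y erefl; rewrite addn0 in e0.
move=> li ltt; rewrite nth_cat e0 -addnA ltnNge leq_addr /= addKn.
rewrite -addSnnS; apply: IH => //; last by rewrite addSnnS.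
by move=> j z lj; rewrite addSnnS; apply: e.
Qed.

End Pieces.

Lemma pieces_id A k (l : seq A) : pieces (fun _ x => [:: x]) k l = l.
Proof. by elim: l k => //= x l IH k; rewrite IH. Qed.

(** The local [off] of [subst]: numbers from here on go to the internal nodes of the graph replacing
    edge [i]. *)
Definition offset L (G : hgraph L) (f : nat -> option (hgraph L)) i :=
  nV G + sumn [seq ninternal f j | j <- iota 0 i].

Lemma offsetS L (G : hgraph L) f i :
  offset G f i.+1 = offset G f i + ninternal f i.
Proof.
by rewrite /offset -addn1 iotaD map_cat sumn_cat /= addn0 addnA.
Qed.

Lemma leq_offset L (G : hgraph L) f i j : i <= j -> offset G f i <= offset G f j.
Proof.
move/subnK<-; elim: (j - i) => //= k IH.
by rewrite addSn offsetS; apply: leq_trans IH _; rewrite leq_addr.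
Qed.

Lemma nV_offset L (G : hgraph L) f i : nV G <= offset G f i.
Proof. exact: leq_addr. Qed.

Lemma nV_subst L (G : hgraph L) f : nV (subst G f) = offset G f (size (edges G)).
Proof. by []. Qed.

Lemma edges_subst L (G : hgraph L) f : edges (subst G f) =
  pieces (fun i x => if f i is Some H
    then [seq (y.1, map (embed x.2 (offset G f i) H) y.2) | y <- edges H]
    else [:: x]) 0 (edges G).
Proof. by rewrite -pieces_zip. Qed.

Section Embed.
Variables (L : Type) (H : hgraph L) (b : seq nat) (o : nat).
Hypotheses (wH : wf_struct H) (sb : size b = size (ext H)).

Lemma mem_intn v : (v \in intn H) = (v < nV H) && (v \notin ext H).
Proof. by rewrite mem_filter mem_iota andbC. Qed.

Lemma uniq_intn : uniq (intn H).
Proof. by rewrite filter_uniq ?iota_uniq. Qed.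

Lemma map_embed_ext : map (embed b o H) (ext H) = b.
Proof.
have [_ [_ ux]] := wH; apply: (@eq_from_nth _ 0); rewrite size_map //.
by move=> i lti; rewrite (nth_map 0) // /embed mem_nth // index_uniq.
Qed.

Lemma embed_intn v : v \in intn H -> embed b o H v = o + index v (intn H).
Proof. by rewrite mem_intn /embed => /andP[_ /negPf->]. Qed.

Lemma map_embed_intn : map (embed b o H) (intn H) = iota o (size (intn H)).
Proof.
apply: (@eq_from_nth _ 0); rewrite size_map ?size_iota //.
move=> i lti; rewrite (nth_map 0) // embed_intn ?mem_nth //.
by rewrite nth_iota // index_uniq // uniq_intn.
Qed.

Hypotheses (ub : uniq b) (bo : all (fun v => v < o) b).

Lemma embed_lt v : v < nV H -> embed b o H v < o + size (intn H).
Proof.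
move=> ltv; case: (boolP (v \in ext H)) => vx.
  rewrite /embed vx; apply: (@leq_trans o); last exact: leq_addr.
  by apply: (allP bo); rewrite mem_nth // sb index_mem.
have vi : v \in intn H by rewrite mem_intn ltv.
by rewrite embed_intn // ltn_add2l index_mem.
Qed.

(** External nodes land below [o] and internal ones from [o] on; within each kind the position in a
    duplicate-free list determines the node. *)
Lemma embed_inj : inj_on (nV H) (embed b o H).
Proof.
have ext_lt v : v \in ext H -> embed b o H v < o.
  by move=> vx; rewrite /embed vx; apply: (allP bo); rewrite mem_nth // sb index_mem.
have int_ge v : v \in intn H -> o <= embed b o H v.
  by move=> vi; rewrite embed_intn // leq_addr.
move=> u v ltu ltv.
have := mem_intn u; have := mem_intn v; rewrite ltu ltv /=.
case: (boolP (u \in ext H)) => ux; case: (boolP (v \in ext H)) => vx /= vi ui e.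
- move: e; rewrite /embed ux vx => /eqP; rewrite nth_uniq ?sb ?index_mem // => /eqP e.
  by rewrite -(nth_index 0 ux) e nth_index.
- by have := ext_lt _ ux; have := int_ge _ vi; lia.
- by have := ext_lt _ vx; have := int_ge _ ui; lia.
- move: e; rewrite !embed_intn // => /addnI e.
  by rewrite -(nth_index 0 ui) e nth_index.
Qed.

End Embed.

Definition substitutable L (G : hgraph L) (f : nat -> option (hgraph L)) := forall i x H,
  onth (edges G) i = Some x -> f i = Some H ->
  wf_struct H /\ size x.2 = size (ext H).

(** What edge [i] contributes to the edges of a named replacement graph, where [rs i] names the
    graph put in its place; [internals] is its analogue for internal names. *)
Definition kept_or_edges L (f : nat -> option (hgraph L)) (rs : nat -> nat -> nat) i (y : L * seq nat) :=
  if f i is Some H then rn (rs i) (edges H) else [:: y].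

Definition internals L (f : nat -> option (hgraph L)) (rs : nat -> nat -> nat) i (y : L * seq nat) :=
  if f i is Some H then map (rs i) (intn H) else [::].

Section Subst.
Variables (L : Type) (G : hgraph L) (f : nat -> option (hgraph L)).
Hypotheses (wG : wf_struct G) (sf : substitutable G f).

Lemma att_lt i x : onth (edges G) i = Some x ->
  uniq x.2 /\ all (fun v => v < offset G f i) x.2.
Proof.
move=> Gx; have [|wx ux] := (wG).1 x; first by apply/In_onth; exists i.
split=> //; apply: sub_all wx => v ltv; exact: leq_trans ltv (nV_offset _ _ _).
Qed.

Lemma offset_lt i x H : onth (edges G) i = Some x -> f i = Some H ->
  offset G f i + size (intn H) <= nV (subst G f).
Proof.
move=> Gx fH; have lti : i < size (edges G) by rewrite -onthTE Gx.
by have := leq_offset G f lti; rewrite offsetS /ninternal fH nV_subst.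
Qed.

Lemma embed_subst_lt i x H v : onth (edges G) i = Some x -> f i = Some H ->
  v < nV H -> embed x.2 (offset G f i) H v < nV (subst G f).
Proof.
move=> Gx fH ltv; have [wH sx] := sf Gx fH; have [ux ltx] := att_lt Gx.
exact: leq_trans (embed_lt sx ltx ltv) (offset_lt Gx fH).
Qed.

Lemma embed_subst_inj i x H : onth (edges G) i = Some x -> f i = Some H ->
  inj_on (nV H) (embed x.2 (offset G f i) H).
Proof.
move=> Gx fH; have [wH sx] := sf Gx fH; have [ux ltx] := att_lt Gx.
exact: embed_inj.
Qed.

Lemma intn_subst : intn (subst G f) = intn G ++
  pieces (fun i _ => iota (offset G f i) (ninternal f i)) 0 (edges G).
Proof.
have [_ [/allP wx _]] := wG.
rewrite {1}/intn nV_subst {1}/offset iotaD filter_cat add0n; congr (_ ++ _).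
rewrite (_ : filter _ _ = iota (nV G) (sumn [seq ninternal f j | j <- iota 0 (size (edges G))])).
  have: nV G = offset G f 0 by rewrite /offset addn0.
  move: (nV G) => n ->; elim: (edges G) 0 => //= x l IH k.
  by rewrite iotaD -offsetS IH.
apply/all_filterP/allP => v; rewrite mem_iota => /andP[lev _].
by apply/negP => /wx; rewrite ltnNge lev.
Qed.

Lemma wf_subst : wf_struct (subst G f).
Proof.
have lt0 := nV_offset G f (size (edges G)); rewrite -nV_subst in lt0.
split; last first.
  have [_ [wx ux]] := wG; split=> //; apply: sub_all wx => v ltv.
  exact: leq_trans ltv lt0.
rewrite edges_subst => y.
have: forall i x, onth (edges G) i = Some x ->
    forall y, List.In y (if f (0 + i) is Some H
    then [seq (y.1, map (embed x.2 (offset G f (0 + i)) H) y.2) | y <- edges H]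
    else [:: x]) -> all (fun v => v < nV (subst G f)) y.2 /\ uniq y.2.
  move=> i x Gx z; rewrite add0n; case fH: (f i) => [H|]; last first.
    case=> // <-; have [|wx ux] := (wG).1 x; first by apply/In_onth; exists i.
    by split=> //; apply: sub_all wx => v ltv; apply: leq_trans ltv lt0.
  move=> /List.in_map_iff[w [<- Hw]] /=; have [wH sx] := sf Gx fH.
  have [ww uw] := (wH).1 _ Hw; split.
    by rewrite all_map; apply: sub_all ww => v /= ltv; apply: embed_subst_lt Gx fH ltv.
  exact: map_inj_on_uniq (embed_subst_inj Gx fH) ww uw.
elim: (edges G) 0 => //= x l IH k Hl /In_cat[h|].
  by apply: (Hl 0 x erefl); rewrite addn0.
by apply: IH => i z lz; rewrite addSnnS; apply: Hl.
Qed.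

Lemma subst_named r rG rs :
  (forall v, v < nV G -> r v = rG v) ->
  (forall i x H, onth (edges G) i = Some x -> f i = Some H ->
     forall v, v < nV H -> r (embed x.2 (offset G f i) H v) = rs i v) ->
  rn r (edges (subst G f)) = pieces (kept_or_edges f rs) 0 (rn rG (edges G)) /\
  map r (intn (subst G f)) =
    map rG (intn G) ++ pieces (internals f rs) 0 (rn rG (edges G)).
Proof.
move=> rG_r rs_r; split.
  rewrite edges_subst /rn map_pieces pieces_map; apply: eq_pieces => i x Gx.
  rewrite add0n /kept_or_edges; case fH: (f i) => [H|] /=.
    rewrite -map_comp; apply/List.map_ext_in => y Hy /=; congr (_, _).
    rewrite -map_comp; apply/eq_in_map => v vy; apply: rs_r => //.
    by have [[/(_ _ Hy)[/allP wy _] _] _] := sf Gx fH; apply: wy.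
  congr [:: (_, _)]; apply/eq_in_map => v vx; apply: rG_r.
  have [|/allP wx _] := (wG).1 x; first by apply/In_onth; exists i.
  exact: wx.
rewrite intn_subst map_cat; congr (_ ++ _).
  by apply/eq_in_map => v; rewrite mem_filter mem_iota add0n => /andP[_ /andP[_ /rG_r]].
rewrite map_pieces pieces_map; apply: eq_pieces => i x Gx.
rewrite add0n /internals /ninternal; case fH: (f i) => [H|] //.
rewrite -(map_embed_intn H x.2) -map_comp; apply/eq_in_map => v.
by rewrite mem_intn => /andP[ltv _]; apply: rs_r.
Qed.

(** Nodes of [G] keep their numbers in the result, so [r] also names [G]; pulled back along [embed],
    it names each inserted graph. *)
Lemma subst_split r : inj_on (nV (subst G f)) r -> exists rs,
  [/\ inj_on (nV G) r,
      forall i x H, onth (edges G) i = Some x -> f i = Some H ->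
        inj_on (nV H) (rs i) /\ map (rs i) (ext H) = map r x.2,
      rn r (edges (subst G f)) = pieces (kept_or_edges f rs) 0 (rn r (edges G)) &
      map r (intn (subst G f)) =
        map r (intn G) ++ pieces (internals f rs) 0 (rn r (edges G))].
Proof.
move=> ri; pose rs i v :=
  if onth (edges G) i is Some x then
    if f i is Some H then r (embed x.2 (offset G f i) H v) else 0 else 0.
exists rs; have [||? ?] := @subst_named r r rs => //.
  by move=> i x H Gx fH v _; rewrite /rs Gx fH.
split=> //.
  have lt0 := nV_offset G f (size (edges G)); rewrite -nV_subst in lt0.
  by move=> u v ltu ltv; apply: ri; apply: leq_trans lt0.
move=> i x H Gx fH; rewrite /rs Gx fH; split.
  move=> u v ltu ltv /ri e; apply: (embed_subst_inj Gx fH) => //.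
  by apply: e; apply: embed_subst_lt.
have [wH sx] := sf Gx fH.
by rewrite -[in RHS](@map_embed_ext _ H x.2 (offset G f i) wH sx) -map_comp.
Qed.

(** The hypotheses are the conditions for gluing: agreement on fused nodes and distinct names
    elsewhere. The list [s] holds the names in the order in which [subst] numbers the nodes, so
    [nth 0 s] is the required naming. *)
Lemma subst_glue rG rs :
  (forall i x H, onth (edges G) i = Some x -> f i = Some H ->
     map (rs i) (ext H) = map rG x.2) ->
  uniq (map rG (iota 0 (nV G)) ++ pieces (internals f rs) 0 (rn rG (edges G))) ->
  exists r,
  [/\ inj_on (nV (subst G f)) r,
      forall v, v < nV G -> r v = rG v,
      rn r (edges (subst G f)) = pieces (kept_or_edges f rs) 0 (rn rG (edges G)) &
      map r (intn (subst G f)) =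
        map rG (intn G) ++ pieces (internals f rs) 0 (rn rG (edges G))].
Proof.
set s := _ ++ _ => rs_ext us.
have sz i x : onth (rn rG (edges G)) i = Some x ->
    size (internals f rs (0 + i) x) = ninternal f (0 + i).
  by move=> _; rewrite /internals /ninternal; case: (f _) => // H; rewrite size_map.
have ss : size s = nV (subst G f).
  by rewrite size_cat size_map size_iota (size_pieces sz) size_map.
have rG_nth v : v < nV G -> nth 0 s v = rG v.
  move=> ltv; rewrite nth_cat size_map size_iota ltv (nth_map 0) ?size_iota //.
  by rewrite nth_iota.
exists (nth 0 s); have [|e1 e2] := @subst_named (nth 0 s) rG rs rG_nth.
  move=> i x H Gx fH v ltv; case: (boolP (v \in ext H)) => vx.
    have [wH sx] := sf Gx fH; have [|/allP wx _] := (wG).1 x.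
      by apply/In_onth; exists i.
    rewrite /embed vx rG_nth; last by apply: wx; rewrite mem_nth // sx index_mem.
    rewrite -(nth_map _ 0) ?sx ?index_mem // -(rs_ext _ _ _ Gx fH).
    by rewrite (nth_map 0) ?index_mem // nth_index.
  have vi : v \in intn H by rewrite mem_intn ltv.
  rewrite embed_intn // nth_cat size_map size_iota ltnNge /offset -addnA leq_addr /=.
  rewrite addKn (nth_pieces _ sz (x := (x.1, map rG x.2))).
  - rewrite add0n /internals fH (nth_map 0) ?index_mem //.
    by rewrite nth_index.
  - by rewrite onth_map Gx.
  - by rewrite add0n /ninternal fH index_mem.
split=> // u v; rewrite -ss => ltu ltv /eqP.
by rewrite nth_uniq // => /eqP.
Qed.

End Subst.

Lemma onth_split T (l : seq T) e x : onth l e = Some x ->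
  exists l1 l2, l = l1 ++ x :: l2 /\ size l1 = e.
Proof.
elim: l e => [|y l IH] [|e] //= => [[->]|/IH[l1 [l2 [-> <-]]]].
  by exists [::], l.
by exists (y :: l1), l2.
Qed.

Lemma onth_mid T (l1 l2 : seq T) x : onth (l1 ++ x :: l2) (size l1) = Some x.
Proof. by rewrite onth_cat ltnn subnn. Qed.

Lemma rn_cat L r (l1 l2 : seq (L * seq nat)) : rn r (l1 ++ l2) = rn r l1 ++ rn r l2.
Proof. exact: map_cat. Qed.

Lemma onth_rn L r (l : seq (L * seq nat)) i y : onth (rn r l) i = Some y ->
  exists2 x, onth l i = Some x & y = (x.1, map r x.2).
Proof. by rewrite onth_map; case: onth => //= x [<-]; exists x. Qed.

Lemma pieces_at A B (h : nat -> A -> seq B) g l1 x l2 :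
  (forall i y, i != size l1 -> h i y = g y) ->
  pieces h 0 (l1 ++ x :: l2) =
  pieces (fun _ => g) 0 l1 ++ h (size l1) x ++ pieces (fun _ => g) 0 l2.
Proof.
move=> hg; rewrite pieces_cat /= add0n; congr (_ ++ (_ ++ _)).
  apply: eq_pieces => i y; rewrite add0n => ly; apply: hg.
  by rewrite neq_ltn -onthTE ly.
by apply: eq_pieces => i y ly; apply: hg; rewrite addSn; lia.
Qed.

Lemma In_pieces A B (h : nat -> A -> seq B) k l i x z :
  onth l i = Some x -> List.In z (h (k + i) x) -> List.In z (pieces h k l).
Proof.
elim: l k i => [|y l IH] k [|i] //=.
  by case=> ->; rewrite addn0 => hz; apply/In_cat; left.
by move=> li; rewrite -addSnnS => hz; apply/In_cat; right; apply: IH li hz.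
Qed.

Lemma edges_subst1 L (G H : hgraph L) l1 x l2 : edges G = l1 ++ x :: l2 ->
  exists g, edges (subst1 G (size l1) H) =
    l1 ++ [seq (y.1, map g y.2) | y <- edges H] ++ l2.
Proof.
move=> eG; exists (embed x.2 (offset G (fun i => if i == size l1 then Some H else None)
  (size l1)) H).
rewrite /subst1 edges_subst eG (@pieces_at _ _ _ (fun y => [:: y])).
  by rewrite !pieces_id eqxx.
by move=> i y /negPf ->.
Qed.

Section Subst1.
Variables (L : Type) (G H : hgraph L) (l1 l2 : seq (L * seq nat)) (x : L * seq nat).
Hypotheses (wG : wf_struct G) (wH : wf_struct H).
Hypotheses (eG : edges G = l1 ++ x :: l2) (sx : size x.2 = size (ext H)).
Let e := size l1.
Let f := fun i => if i == e then Some H else None.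

Let pieces1 B (h : nat -> L * seq nat -> seq B) rG g
    (hg : forall i y, i != e -> h i y = g y) :
  pieces h 0 (rn rG (edges G)) =
  pieces (fun _ => g) 0 (rn rG l1) ++ h e (x.1, map rG x.2) ++
  pieces (fun _ => g) 0 (rn rG l2).
Proof.
by rewrite eG rn_cat (@pieces_at _ _ h g) size_map.
Qed.

Lemma substitutable1 : substitutable G f.
Proof.
move=> i y H'; rewrite /f eG; case: eqP => // ->; rewrite onth_mid => -[<-] [<-].
by split.
Qed.

Lemma subst1_split r : inj_on (nV (subst1 G e H)) r -> exists rH,
  [/\ inj_on (nV G) r, inj_on (nV H) rH, map rH (ext H) = map r x.2,
      rn r (edges (subst1 G e H)) = rn r l1 ++ rn rH (edges H) ++ rn r l2 &
      map r (intn (subst1 G e H)) = map r (intn G) ++ map rH (intn H)].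
Proof.
rewrite -[subst1 _ _ _]/(subst G f) => ri; have [rs [riG rsP -> ->]] := subst_split wG substitutable1 ri.
have [||riH extH] := rsP e x H; [by rewrite eG onth_mid | by rewrite /f eqxx |].
exists (rs e); split=> //.
- rewrite (@pieces1 _ _ _ (fun y => [:: y])).
    by rewrite !pieces_id /kept_or_edges /f eqxx.
  by move=> i y /negPf; rewrite /kept_or_edges /f => ->.
- rewrite (@pieces1 _ _ _ (fun y => [::])).
    by rewrite !pieces_nil // /internals /f eqxx cats0.
  by move=> i y /negPf; rewrite /internals /f => ->.
Qed.

Lemma subst1_glue rG rH : map rH (ext H) = map rG x.2 ->
  uniq (map rG (iota 0 (nV G)) ++ map rH (intn H)) -> exists r,
  [/\ inj_on (nV (subst1 G e H)) r, map r (ext (subst1 G e H)) = map rG (ext G),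
      rn r (edges (subst1 G e H)) = rn rG l1 ++ rn rH (edges H) ++ rn rG l2 &
      map r (intn (subst1 G e H)) = map rG (intn G) ++ map rH (intn H)].
Proof.
rewrite -[subst1 _ _ _]/(subst G f) => extH u.
have eI : pieces (internals f (fun _ => rH)) 0 (rn rG (edges G)) = map rH (intn H).
  rewrite (@pieces1 _ _ _ (fun y => [::])).
    by rewrite !pieces_nil // /internals /f eqxx cats0.
  by move=> i y /negPf; rewrite /internals /f => ->.
have [||r [ri rG_r eE eIn]] := @subst_glue _ G f wG substitutable1 rG (fun _ => rH).
- move=> i y H'; rewrite /f eG; case: eqP => // ->; rewrite onth_mid => -[<-] [<-] //.
- by rewrite eI.
exists r; split=> //.
- by apply/eq_in_map => v vx; apply: rG_r; have [_ [/allP wx _]] := wG; apply: wx.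
- rewrite eE (@pieces1 _ _ _ (fun y => [:: y])).
    by rewrite !pieces_id /kept_or_edges /f eqxx.
  by move=> i y /negPf; rewrite /kept_or_edges /f => ->.
- by rewrite eIn eI.
Qed.

End Subst1.

Lemma wf_rmap L L' (g : L -> L') G : wf_struct G -> wf_struct (rmap g G).
Proof.
move=> [wG wx]; split=> // x /List.in_map_iff[y [<- Gy]]; exact: wG Gy.
Qed.

Lemma der_sequent b H A : der b H A -> sequent H A.
Proof.
case=> // p n; split=> /=; last by rewrite size_iota; split=> //; constructor.
have wi : all (fun v => v < n) (iota 0 n) by apply/allP=> v; rewrite mem_iota.
split; first by split=> [x /= [<-|//]|] /=; rewrite iota_uniq.
by move=> t a [[<- <-]|//]; rewrite /= size_iota; split=> //; constructor.
Qed.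

Lemma sequent_wfs K A r : sequent K A -> inj_on (nV K) r ->
  wfs (map r (intn K)) (rn r (edges K)) (map r (ext K)) A.
Proof.
move=> [[wK wl] [wA sA]] ri; split=> //; last by rewrite size_map.
- rewrite -map_cat -(perm_uniq (perm_map r (perm_nodes wK))).
  exact: uniq_map_iota.
- move=> t a h; have [[b Kb eb] ua sub] := wfs_inst wK ri h.
  by have [wt st] := wl _ _ Kb; rewrite eb.
Qed.

Lemma somes_dollar A r (m : seq (option tp * seq nat)) :
  (forall i y, onth m i = Some y -> isSome y.1) ->
  somes (rn r m) = rn r [seq (dollar_to A x.1, x.2) | x <- m].
Proof.
elim: m => //= -[[t|] b] m IH Sm /=; last by have := Sm 0 _ erefl.
by congr (_ :: _); apply: IH => i y; apply: (Sm i.+1).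
Qed.

(** * Edge positions in the rule (÷->) *)

Section DivL.
Variables (N : tp) (D : hgraph (option tp)) (m1 m2 : seq (option tp * seq nat)).
Variables (a0 : seq nat) (e : nat) (Hs : nat -> hgraph tp).
Hypotheses (eD : edges D = m1 ++ (None, a0) :: m2).
Hypotheses (c1 : count (fun x => ~~ isSome x.1) (edges D) = 1).
Let d0 := size m1.
Let f := fun i => if (e <= i < e + size (edges D)) && (i - e != d0)
                  then Some (Hs (i - e)) else None.
Let D' := rmap (dollar_to (Div N D)) D.

Lemma others_Some j y : onth (edges D) j = Some y -> j != d0 -> isSome y.1.
Proof.
move: c1; rewrite eD count_cat /= => c11 Dj nj.
have [c01 c02] : count (fun x => ~~ isSome x.1) m1 = 0 /\
  count (fun x => ~~ isSome x.1) m2 = 0 by lia.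
have H (m : seq (option tp * seq nat)) k z :
    count (fun x => ~~ isSome x.1) m = 0 -> onth m k = Some z -> isSome z.1.
  elim: m k => [|w m IH] [|k] //=; last by case: isSome => //; apply: IH.
  by case E: (isSome w.1) => //= _ [<-]; rewrite E.
move: Dj; rewrite onth_cat; case: ltnP => [ltj|gej]; first exact: H.
have: j - size m1 > 0 by rewrite subn_gt0 ltn_neqAle eq_sym nj.
by case: (j - size m1) => // k _ /=; apply: H.
Qed.

Lemma somes_divL A r : somes (rn r (edges D)) =
  rn r [seq (dollar_to A x.1, x.2) | x <- m1] ++
  rn r [seq (dollar_to A x.1, x.2) | x <- m2].
Proof.
rewrite -!somes_dollar => [|i y mi|i y mi].
- by rewrite eD rn_cat [somes _]pmap_cat.
- apply: (others_Some (j := d0.+1 + i)); last by lia.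
  by rewrite eD onth_cat ltnNge -/d0 addSnnS leq_addr addKn.
- have lti : i < d0 by rewrite /d0 -onthTE mi.
  by apply: (others_Some (j := i)); [rewrite eD onth_cat lti | lia].
Qed.

Lemma tparity_Div : tparity (Div N D) = size a0.
Proof.
rewrite /=; move: c1; rewrite eD count_cat /= => c11.
have H (m : seq (option tp * seq nat)) :
    count (fun x => ~~ isSome x.1) m = 0 -> [seq x <- m | ~~ isSome x.1] = [::].
  by move=> cm; apply: size0nil; rewrite size_filter.
by rewrite filter_cat H //; lia.
Qed.

(** In [H[e/D]] the edges of [D] start at position [e], so those before and after them and the one
    at [e + d0] are kept and contribute through [g]; every other edge [e + j] is replaced and
    contributes [k j]. With [h] arbitrary, the statement serves both the edges and the internal
    names of the conclusion. *)
Lemma pieces_divL B (h : nat -> tp * seq nat -> seq B) (k : nat -> seq B) Y1 Y2 rD g :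
  size Y1 = e ->
  (forall i y, f i = None -> h i y = g y) ->
  (forall j y, e <= e + j < e + size (edges D) -> j != d0 -> h (e + j) y = k j) ->
  pieces h 0 (Y1 ++ rn rD (edges D') ++ Y2) =
  pieces (fun _ => g) 0 Y1 ++
  (pieces (fun j x => if x.1 is Some _ then k j else [::]) 0 (rn rD m1) ++
   g (Div N D, map rD a0) ++
   pieces (fun j x => if x.1 is Some _ then k j else [::]) d0.+1 (rn rD m2)) ++
  pieces (fun _ => g) 0 Y2.
Proof.
move=> sY hg hk; rewrite !pieces_cat add0n sY; congr (_ ++ (_ ++ _)).
- apply: eq_pieces => i y Yi; rewrite add0n hg //.
  have: i < size Y1 by rewrite -onthTE Yi.
  by rewrite sY /f => lti; rewrite leqNgt lti.
- have szD : size (edges D) = d0 + (size m2).+1 by rewrite eD size_cat.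
  have SD i y : onth (edges D) i = Some y -> i < size (edges D).
    by rewrite -onthTE => ->.
  rewrite /= eD map_cat rn_cat pieces_cat /= /rn !size_map -/d0.
  rewrite !pieces_map; congr (_ ++ (_ ++ _)).
  + apply: eq_pieces => i y mi; rewrite add0n.
    have lti : i < d0 by rewrite /d0 -onthTE mi.
    have Di : onth (edges D) i = Some y by rewrite eD onth_cat lti.
    have ni : i != d0 by lia.
    have := others_Some Di ni; case: (y) => [[t|] b] //= _.
    by apply: hk => //; rewrite szD; lia.
  + rewrite hg // /f addKn eqxx andbF //.
  + rewrite -addnS; apply: eq_pieces => i y mi; rewrite -addnA.
    have Di : onth (edges D) (d0.+1 + i) = Some y.
      by rewrite eD onth_cat ltnNge -/d0 addSnnS leq_addr addKn.
    have ni : d0.+1 + i != d0 by lia.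
    have := others_Some Di ni; case: (y) => [[t|] b] //= _.
    apply: hk => //; have := SD _ _ Di; lia.
- apply: eq_pieces => i y _; apply: hg; rewrite /f !size_map.
  by rewrite ifF //; lia.
Qed.

Lemma kept_divL Y1 Y2 rD rs : size Y1 = e ->
  Permutation (pieces (kept_or_edges f rs) 0 (Y1 ++ rn rD (edges D') ++ Y2))
    ((Div N D, map rD a0) :: (Y1 ++ Y2) ++
     pieces (fun j x => if x.1 is Some _ then rn (rs (e + j)) (edges (Hs j)) else [::])
       0 (rn rD (edges D))).
Proof.
move=> sY; rewrite (@pieces_divL _ _ (fun j => rn (rs (e + j)) (edges (Hs j))) _ _ _
  (fun y => [:: y]) sY).
- rewrite !pieces_id eD rn_cat pieces_cat /= size_map add0n -/d0.
  by perm_cat.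
- by move=> i y fi; rewrite /kept_or_edges fi.
- by move=> j y lej nj; rewrite /kept_or_edges /f lej addKn nj.
Qed.

Lemma internals_divL Y1 Y2 rD rs : size Y1 = e ->
  pieces (internals f rs) 0 (Y1 ++ rn rD (edges D') ++ Y2) =
  pieces (fun j x => if x.1 is Some _ then map (rs (e + j)) (intn (Hs j)) else [::])
    0 (rn rD (edges D)).
Proof.
move=> sY; rewrite (@pieces_divL _ _ (fun j => map (rs (e + j)) (intn (Hs j))) _ _ _
  (fun y => [::]) sY).
- rewrite eD rn_cat pieces_cat /= size_map add0n -/d0 !(@pieces_nil _ _ (fun _ _ => [::])) //.
  by rewrite cats0.
- by move=> i y fi; rewrite /internals fi.
- by move=> j y lej nj; rewrite /internals /f lej addKn nj.
Qed.

(** The premises of (÷->) do not tell that [N ÷ D] is well-formed; this is read off the conclusion,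
    once the edge bearing that label is located there. *)
Lemma principal_divL H a l1 l2 : edges H = l1 ++ (N, a) :: l2 -> size l1 = e ->
  exists b, List.In (Div N D, b) (edges (subst (subst1 H e D') f)).
Proof.
move=> eH se; have [g eG1] := edges_subst1 D' eH; exists (map g a0).
rewrite edges_subst; apply: (@In_pieces _ _ _ _ _ (e + d0) (Div N D, map g a0)).
  rewrite -se eG1 onth_cat ltnNge leq_addr addKn /= onth_cat !size_map eD size_cat /=.
  by rewrite addnS ltnS leq_addr !map_cat /= onth_cat !size_map ltnn subnn.
by rewrite add0n /f addKn eqxx andbF; left.
Qed.

Lemma onth_divL Y1 Y2 rD i y H' : size Y1 = e ->
  onth (Y1 ++ rn rD (edges D') ++ Y2) i = Some y -> f i = Some H' ->
  exists j t b, [/\ i = e + j, onth (edges D) j = Some (Some t, b), H' = Hs j &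
                    y = (t, map rD b)].
Proof.
move=> sY; rewrite /f; case: ifP => // /andP[/andP[lei lti] ni] Yi [<-].
move: Yi; rewrite onth_cat sY ltnNge lei /= onth_cat !size_map.
have ltj : i - e < size (edges D) by lia.
rewrite ltj /D' /rn !onth_map; case E: (onth (edges D) (i - e)) => [[o b]|] //= [<-].
have := others_Some E ni; case: o E => // t E _.
by exists (i - e), t, b; split=> //; lia.
Qed.

Lemma substitutable_divL (G1 : hgraph tp) r1 rD Y1 Y2 :
  rn r1 (edges G1) = Y1 ++ rn rD (edges D') ++ Y2 -> size Y1 = e ->
  (forall j t b, onth (edges D) j = Some (Some t, b) ->
     wf_struct (Hs j) /\ size b = size (ext (Hs j))) ->
  substitutable G1 f.
Proof.
move=> eG1 sY HsP i x H' Gx fi.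
have: onth (rn r1 (edges G1)) i = Some (x.1, map r1 x.2) by rewrite onth_map Gx.
rewrite eG1 => h; have [j [t [b [_ Dj -> [_ ex]]]]] := onth_divL sY h fi.
have [? sb] := HsP _ _ _ Dj; split=> //.
by rewrite -sb -(size_map r1) ex size_map.
Qed.

End DivL.

Lemma nds_pieces T Js Fs k :
  (forall i t b, onth T i = Some (Some t, b) -> nd (Js (k + i)) (Fs (k + i)) b t) ->
  nds T (pieces (fun j x => if x.1 is Some _ then Js j else [::]) k T)
        (pieces (fun j x => if x.1 is Some _ then Fs j else [::]) k T).
Proof.
elim: T k => [|[[t|] b] T IH] k d /=; first exact: nds_nil.
- constructor; first by have := d 0 t b erefl; rewrite addn0.
  by apply: IH => i u c Ti; rewrite addSnnS; apply: d.
- by constructor; apply: IH => i u c Ti; rewrite addSnnS; apply: d.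
Qed.

(** * From HL with cut to the named calculus *)

(** The statement ranges over all namings because the quantified premises of [nd_divR] and
    [nd_timesL] use the induction hypothesis at a naming that depends on the instance. *)
Theorem der_nd c K A : der c K A -> forall r, inj_on (nV K) r ->
  nd (map r (intn K)) (rn r (edges K)) (map r (ext K)) A.
Proof.
elim=> {K A}.
- move=> p n r ri; have -> : intn (handle (Prim p n) n) = [::].
    rewrite /intn /=; apply/eqP; rewrite -size_eq0 size_filter -leqn0 leqNgt -has_count.
    by apply/hasPn => v -> .
  apply: nd_ax; last by rewrite size_map size_iota.
  exact: uniq_map_iota.
- move=> H A H' A' d IH /giso_relE[phi iH] tA sq r ri.
  have [[wH _] _] := der_sequent d; have [[wH' _] _] := sq.
  have [_ _ _ eext _] := iH.
  have {}IH := IH _ (isoR_inj iH ri).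
  have wc := sequent_wfs sq ri.
  move: IH wc; rewrite eext -map_comp => IH wc; apply: (nd_iso IH _ _ tA wc).
    by rewrite map_comp; apply: perm_map; apply: isoR_intn iH wH wH'.
  exact: isoR_rn iH.
- move=> H A N D e d0 a a0 Hs He Dd0 dH IH dHs IHs; set f := fun i => _.
  set G1 := subst1 H e _ => sq r ri.
  have [[wH wlH] _] := der_sequent dH; have [[wK wlK] [wA sA]] := sq.
  have [l1 [l2 [eH se]]] := onth_split He; have [m1 [m2 [eD sd]]] := onth_split Dd0.
  subst e d0.
  have HeN : List.In (N, a) (edges H) by apply/In_onth; exists (size l1).
  have [b' /wlK[wND _]] := principal_divL Hs eD eH erefl.
  inversion wND as [|? ? wN wD c1 wl sN|]; subst.
  have [_ sNa] := wlH _ _ HeN.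
  have sa : size (N, a).2 = size (ext (rmap (dollar_to (Div N D)) D)) by rewrite /= -sNa.
  have wD' := wf_rmap (dollar_to (Div N D)) wD.
  have riG1 : inj_on (nV G1) r.
    move=> u v ltu ltv; apply: ri; rewrite nV_subst; apply: leq_trans (nV_offset _ _ _) => //.
  have [rD [riH riD extD eE eI]] := subst1_split wH wD' eH sa riG1.
  have wG1 : wf_struct G1 := wf_subst wH (substitutable1 wD' eH sa).
  have HsP j t b : onth (edges D) j = Some (Some t, b) ->
      wf_struct (Hs j) /\ size b = size (ext (Hs j)).
    move=> Dj; have [[wHs _] [_ st]] := der_sequent (dHs _ _ _ Dj); split=> //.
    by have [|_ <-] := wl t b; [apply/In_onth; exists j | rewrite st].
  have sY : size (rn r l1) = size l1 by rewrite size_map.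
  have sf : substitutable G1 f := substitutable_divL eD c1 eE sY HsP.
  have [rs [_ rsP eE2 eI2]] := subst_split wG1 sf ri.
  have wc := sequent_wfs sq ri; move: wc.
  rewrite eE2 eI2 eE eI -/f (internals_divL N Hs eD c1 (rn r l2) rD rs sY) => wc.
  have pE := kept_divL N Hs eD c1 (rn r l2) rD rs sY.
  have ds := @nds_pieces (rn rD (edges D))
    (fun j => map (rs (size l1 + j)) (intn (Hs j)))
    (fun j => rn (rs (size l1 + j)) (edges (Hs j))) 0.
  have Da0 : List.In (None, a0) (edges D) by apply/In_onth; exists (size m1).
  have dH' : nd (map r (intn H)) ((N, map rD (ext D)) :: rn r l1 ++ rn r l2) (map r (ext H)) A.
    apply: nd_perm (IH r riH) (perm_refl _) _.
    by rewrite eH rn_cat /= [map rD _]extD; perm_cat.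
  rewrite -catA in wc.
  apply: nd_perm (nd_divL Da0 riD dH' (ds _) (wfs_perm wc (perm_refl _) pE)) _ (Permutation_sym pE).
    move=> i t b /onth_rn[[o b0] Di [et ->]]; rewrite add0n; subst o.
    have lti : i < size (edges D) by rewrite -onthTE Di.
    have fi : f (size l1 + i) = Some (Hs i).
      rewrite /f addKn leq_addr ltn_add2l lti /= ifT //; apply/eqP => ei.
      by rewrite ei Dd0 in Di.
    have: onth (rn r (edges G1)) (size l1 + i) = Some (t, map rD b0).
      rewrite eE onth_cat size_map ltnNge leq_addr addKn /= onth_cat !size_map lti.
      by rewrite /rn !onth_map Di.
    move=> /onth_rn[x G1x [_ ->]]; have [riHs <-] := rsP _ _ _ G1x fi.
    exact: IHs Di _ riHs.
  by rewrite catA.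
- move=> F N D d0 a0 Dd0 d IH sq r ri.
  have [[wF _] [wND sF]] := sq.
  have [m1 [m2 [eD sd]]] := onth_split Dd0; subst d0.
  have Da0 : List.In (None, a0) (edges D) by apply/In_onth; exists (size m1).
  inversion wND as [|? ? wN wD c1 wl sN|]; subst.
  apply: (nd_divR Da0) (sequent_wfs sq ri) => rD riD ea0 u.
  have wD' := wf_rmap (dollar_to (Prim 0 0)) wD.
  have eD' : edges (rmap (dollar_to (Prim 0 0)) D) =
    [seq (dollar_to (Prim 0 0) x.1, x.2) | x <- m1] ++ (Prim 0 0, a0) ::
    [seq (dollar_to (Prim 0 0) x.1, x.2) | x <- m2] by rewrite /= eD map_cat.
  have sa : size (Prim 0 0, a0).2 = size (ext F).
    by rewrite /= -(size_map rD a0) ea0 size_map.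
  (* The arbitrary instance [rD] of [D] and the given naming [r] of [F] agree on the [$]-edge by
     [ea0], so they glue to a naming of the premise [D[d0/F]]. *)
  have [||r' [ri' extr' eE eI]] := subst1_glue wD' wF eD' sa (rG := rD) (rH := r).
  + by rewrite ea0.
  + by rewrite uniq_catC.
  have := IH r'; rewrite -[size m1](size_map (fun x => (dollar_to (Prim 0 0) x.1, x.2))).
  move=> /(_ ri'); rewrite extr' eE eI => d'.
  apply: nd_perm d' (perm_refl _) _.
  by rewrite (somes_divL eD c1 (Prim 0 0)); perm_cat.
- move=> G F A e a Ge d IH sq r ri.
  have [[wG wl] _] := sq.
  have [l1 [l2 [eG se]]] := onth_split Ge; subst e.
  have [wTF sa] : wf_tp (Times F) /\ tparity (Times F) = size a.
    by apply: wl; apply/In_onth; exists (size l1).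
  inversion wTF as [| |? wF wlF]; subst.
  have wc := sequent_wfs sq ri.
  have pE : Permutation (rn r (edges G)) ((Times F, map r a) :: rn r l1 ++ rn r l2).
    by rewrite eG rn_cat /=; perm_cat.
  apply: nd_perm (nd_timesL _ (wfs_perm wc (perm_refl _) pE)) (perm_refl _) (Permutation_sym pE).
  move=> rF riF ea u.
  have [||r' [ri' extr' eE eI]] := subst1_glue wG wF eG (esym sa) (rG := r) (rH := rF) => //.
    have nG := fun x => count_nodes r x wG.
    by ucount; apply/uniq_countP => x; move: (u x) (nG x); count_lia.
  have := IH r' ri'; rewrite extr' eE eI => d'; apply: nd_perm d' (perm_refl _) _.
  by perm_cat.
- move=> M Hs dHs IHs; set f := fun i => _; move=> sq r ri.
  have [_ [wTM _]] := sq; inversion wTM as [| |? wM wl]; subst.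
  have sf : substitutable M f.
    move=> i x H Mx [<-]; have Mx' : onth (edges M) i = Some (x.1, x.2) by case: (x) Mx.
    have [[wHs _] [_ st]] := der_sequent (dHs _ _ _ Mx'); split=> //.
    by have [|_ <-] := wl x.1 x.2; [apply/In_onth; exists i | rewrite st].
  have [rs [riM rsP eE eI]] := subst_split wM sf ri.
  have wc := sequent_wfs sq ri; move: wc; rewrite eE eI.
  pose T := rn r [seq (Some x.1, x.2) | x <- edges M].
  have -> : pieces (kept_or_edges f rs) 0 (rn r (edges M)) =
      pieces (fun j x => if x.1 is Some _ then rn (rs j) (edges (Hs j)) else [::]) 0 T.
    by rewrite /T /rn !pieces_map; apply: eq_pieces.
  have -> : pieces (internals f rs) 0 (rn r (edges M)) =
      pieces (fun j x => if x.1 is Some _ then map (rs j) (intn (Hs j)) else [::]) 0 T.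
    by rewrite /T /rn !pieces_map; apply: eq_pieces.
  move=> wc; apply: (nd_timesR riM _ wc).
  apply: (@nds_pieces T (fun j => map (rs j) (intn (Hs j))) (fun j => rn (rs j) (edges (Hs j)))).
  move=> i t b /onth_rn[[o b0]]; rewrite onth_map; case Mi: (onth (edges M) i) => [[t' b1]|] //=.
  move=> [<- <-] [-> ->]; rewrite add0n.
  have [riHs <-] := rsP i _ (Hs i) Mi erefl.
  exact: IHs Mi _ riHs.
- move=> H G A B e0 b0 _ dH IHH dG IHG Ge sq r ri.
  have [[wH _] [_ sH]] := der_sequent dH; have [[wG wlG] _] := der_sequent dG.
  have [l1 [l2 [eG se]]] := onth_split Ge; subst e0.
  have [_ sA] : wf_tp A /\ tparity A = size b0.
    by apply: wlG; apply/In_onth; exists (size l1).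
  have sa : size (A, b0).2 = size (ext H) by rewrite /= -sA.
  have wc := sequent_wfs sq ri; move: wc.
  have [rH [riG riH extH -> ->]] := subst1_split wG wH eG sa ri => wc.
  have dH' := IHH _ riH; rewrite extH in dH'.
  have pG : Permutation (rn r (edges G)) ((A, map r b0) :: rn r l1 ++ rn r l2).
    by rewrite eG rn_cat /=; perm_cat.
  have [u _ _ _] := wc.
  apply: nd_perm (nd_cut (teq_refl A) dH' (IHG _ riG) pG (teq_refl A) u) (perm_refl _) _.
  by perm_cat.
Qed.

(** * From the named calculus to HL *)

(** Numbers the names by their position in [X ++ I]; the inverse naming is [nth 0 (X ++ I)]. With
    [X] in front, the external string is an initial segment and the axiom becomes literally a
    [handle]. *)
Definition mk (I : seq nat) (E : seq (tp * seq nat)) (X : seq nat) : hgraph tp :=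
  HGraph (size (X ++ I)) (rn (index^~ (X ++ I)) E) (iota 0 (size X)).

Section Mk.
Variables (I : seq nat) (E : seq (tp * seq nat)) (X : seq nat) (A : tp).
Hypothesis w : wfs I E X A.
Let nm := nth 0 (X ++ I).

Lemma mk_index a : {subset a <= I ++ X} -> map nm (map (index^~ (X ++ I)) a) = a.
Proof.
move=> sub; rewrite -map_comp -[RHS]map_id; apply/eq_in_map => v va /=.
by rewrite /nm nth_index //; have := sub _ va; rewrite !mem_cat orbC.
Qed.

Lemma mk_edges : rn nm (edges (mk I E X)) = E.
Proof.
have [_ wE _ _] := w; rewrite /= /rn -map_comp.
elim: E wE => //= -[t a] l IH wE; rewrite IH => [|u b lb]; last by apply: wE; right.
by have [_ _ _ /mk_index->] := wE _ _ (or_introl erefl).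
Qed.

Lemma mk_intn : map nm (intn (mk I E X)) = I.
Proof.
have -> : intn (mk I E X) = iota (size X) (size I).
  rewrite /intn /= size_cat iotaD filter_cat (_ : filter _ (iota 0 _) = [::]).
    by apply/all_filterP/allP => v; rewrite !mem_iota; lia.
  apply/eqP; rewrite -size_eq0 size_filter -leqn0 leqNgt -has_count.
  by apply/hasPn => v ->.
apply: (@eq_from_nth _ 0); rewrite size_map size_iota // => i lti.
rewrite (nth_map 0) ?size_iota // nth_iota // /nm nth_cat ltnNge leq_addr /=.
by rewrite addKn.
Qed.

Lemma mk_ext : map nm (ext (mk I E X)) = X.
Proof.
apply: (@eq_from_nth _ 0); rewrite size_map size_iota // => i lti.
by rewrite (nth_map 0) ?size_iota // nth_iota // /nm nth_cat lti.
Qed.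

Lemma mk_inj : inj_on (nV (mk I E X)) nm.
Proof.
have [u _ _ _] := w; rewrite uniq_catC in u.
by move=> i j /= lti ltj /eqP; rewrite /nm nth_uniq // => /eqP.
Qed.

Lemma wf_mk : wf_struct (mk I E X).
Proof.
have [_ wE _ _] := w; split; last first.
  split; rewrite /= ?iota_uniq //; apply/allP=> v; rewrite mem_iota size_cat; lia.
move=> _ /List.in_map_iff[[t a] [<- Ea]] /=; have [_ _ ua sub] := wE _ _ Ea.
have sub' v : v \in a -> v \in X ++ I by move/sub; rewrite !mem_cat orbC.
split.
  by rewrite all_map; apply/allP=> v va /=; rewrite index_mem sub'.
rewrite map_inj_in_uniq // => u v ua' va e.
by rewrite -(nth_index 0 (sub' _ ua')) e nth_index // sub'.
Qed.

(** Labels and arities are insensitive to names, so the typing of [K] can be taken from its named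
    copy; only the node structure is left to check. *)
Lemma sequent_named (K : hgraph tp) r : wf_struct K ->
  Permutation (rn r (edges K)) E -> map r (ext K) = X -> sequent K A.
Proof.
have [_ wE wA sX] := w.
move=> wK pE eX; split; last by rewrite -sX -eX size_map.
split=> // t a Ka; have: List.In (t, map r a) E.
  apply: Permutation_in pE _; apply/List.in_map_iff.
  by exists (t, a).
by move=> /wE[wt st _ _]; rewrite -(size_map r a).
Qed.

Lemma mk_sequent : sequent (mk I E X) A.
Proof.
apply: (@sequent_named _ nm wf_mk); last exact: mk_ext.
by rewrite mk_edges; apply: Permutation_refl.
Qed.

End Mk.

Lemma map_inj_on n r a b : inj_on n r -> all (fun v => v < n) a ->
  all (fun v => v < n) b -> map r a = map r b -> a = b.
Proof.
move=> ri; elim: a b => [|x a IH] [|y b] //= /andP[ltx lta] /andP[lty ltb] [exy eab].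
by congr (_ :: _); [apply: ri | apply: IH].
Qed.

(** Equal named copies come from isomorphic graphs: the isomorphism takes the name of a node under
    [r] and returns the node bearing it under [r']. *)
Lemma giso_named (K K' : hgraph tp) r r' : wf_struct K -> wf_struct K' ->
  inj_on (nV K) r -> inj_on (nV K') r' ->
  perm_eq (map r (intn K)) (map r' (intn K')) ->
  permR eqe (rn r (edges K)) (rn r' (edges K')) ->
  map r (ext K) = map r' (ext K') -> giso K K'.
Proof.
move=> wK wK' ri ri' pI pE eX.
pose s' := map r' (iota 0 (nV K')); pose phi v := index (r v) s'.
have pN : perm_eq (map r (iota 0 (nV K))) s'.
  apply: perm_trans (perm_map r (perm_nodes wK)) _.
  apply: (@perm_trans _ (map r' (intn K' ++ ext K'))).
    by rewrite !map_cat eX perm_cat2r.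
  by apply: perm_map; rewrite perm_sym; apply: perm_nodes.
have eN : nV K = nV K' by have := perm_size pN; rewrite !size_map !size_iota.
have r_s' v : v < nV K -> r v \in s'.
  by move=> ltv; rewrite -(perm_mem pN) map_f // mem_iota.
have ltphi v : v < nV K -> phi v < nV K'.
  by move/r_s'; rewrite -index_mem size_map size_iota.
have phiK v : v < nV K -> r' (phi v) = r v.
  move=> ltv; rewrite -[RHS](nth_index 0 (r_s' _ ltv)) (nth_map 0) ?size_iota ?ltphi //.
  by rewrite nth_iota ?ltphi.
have map_phi a b : all (fun v => v < nV K) a -> all (fun v => v < nV K') b ->
    map r' b = map r a -> b = map phi a.
  move=> la lb e; apply: (map_inj_on ri' lb).
    by rewrite all_map; apply: sub_all la.
  rewrite e -map_comp; apply/eq_in_map => v va /=.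
  by rewrite phiK //; apply: (allP la).
apply/giso_relE; exists phi; split=> //.
- by move=> u v ltu ltv e; apply: ri => //; rewrite -phiK // e phiK.
- by have [_ [? _]] := wK; have [_ [? _]] := wK'; apply: map_phi.
- apply: permR_impl (permR_map_inv pE) _ => x y Kx K'y /= [txy e]; split=> //.
  by have [? _] := wK.1 _ Kx; have [? _] := wK'.1 _ K'y; apply: map_phi.
Qed.

Lemma der_named c (K K' : hgraph tp) A A' r r' : der c K A ->
  inj_on (nV K) r -> inj_on (nV K') r' ->
  perm_eq (map r (intn K)) (map r' (intn K')) ->
  permR eqe (rn r (edges K)) (rn r' (edges K')) ->
  map r (ext K) = map r' (ext K') -> teq A A' -> sequent K' A' -> der c K' A'.
Proof.
move=> d ri ri' pI pE eX tA sq; apply: (der_iso d _ tA sq).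
have [[wK _] _] := der_sequent d; have [[wK' _] _] := sq.
exact: giso_named wK wK' ri ri' pI pE eX.
Qed.

(** One instance is enough on the way back to HL. It is prescribed on [a] and shifts all other nodes
    by [m], which exceeds every name in [L ++ X] because a sum of naturals bounds its terms. *)
Lemma fresh_instance n (a X L : seq nat) : uniq a -> uniq X -> size a = size X ->
  exists r, [/\ inj_on n r, map r a = X &
                forall v, v \notin a -> r v \notin L].
Proof.
move=> ua uX sa; pose m := (sumn (L ++ X)).+1.
have ltm x : x \in L ++ X -> x < m.
  rewrite /m ltnS; elim: (L ++ X) => //= y s IH; rewrite inE => /orP[/eqP->|/IH].
    exact: leq_addr.
  by move=> le; apply: leq_trans le (leq_addl _ _).
pose r v := if v \in a then nth 0 X (index v a) else m + v.
have r_in v : v \in a -> r v \in X.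
  by move=> va; rewrite /r va mem_nth // -sa index_mem.
exists r; split.
- move=> u v _ _; case: (boolP (u \in a)) => ha; case: (boolP (v \in a)) => va.
  + rewrite /r ha va => /eqP; rewrite nth_uniq // -?sa ?index_mem // => /eqP e.
    by rewrite -(nth_index 0 ha) e nth_index.
  + have := ltm (r u); rewrite mem_cat r_in ?orbT // => /(_ isT).
    by rewrite {3}/r (negPf va); lia.
  + have := ltm (r v); rewrite mem_cat r_in ?orbT // => /(_ isT).
    by rewrite {2}/r (negPf ha); lia.
  + by rewrite /r (negPf ha) (negPf va) => /addnI.
- apply: (@eq_from_nth _ 0); rewrite size_map // => i lti.
  by rewrite (nth_map 0) // /r mem_nth // index_uniq.
- move=> v va; apply/negP => rL; have := ltm (r v).
  by rewrite mem_cat rL /r (negPf va) => /(_ isT); lia.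
Qed.

(** HL indexes side premises by edge position whereas [nds] is a list. The start [k] is arbitrary
    because positions shift along the recursion on [T]. *)
Definition derivable_pieces T J F := forall k, exists Js Fs,
  [/\ J = pieces (fun j x => if x.1 is Some _ then Js j else [::]) k T,
      F = pieces (fun j x => if x.1 is Some _ then Fs j else [::]) k T &
      forall i t b, onth T i = Some (Some t, b) ->
        wfs (Js (k + i)) (Fs (k + i)) b t /\
        der false (mk (Js (k + i)) (Fs (k + i)) b) t].

Lemma Permutation_eqe E E' : Permutation E E' -> permR eqe E E'.
Proof. by move=> p; apply: permR_Permr p (permR_eqe_refl _). Qed.

(** The matching rule of HL, applied to graphs of the form [mk], yields a graph that is only
    isomorphic to the desired one; [der_named] closes the gap by comparing names. *)
Theorem nd_der I E X A : nd I E X A -> der false (mk I E X) A.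
Proof.
move: I E X A; apply: (@nd_mut _ derivable_pieces).
- move=> p n a ua sa; rewrite (_ : mk _ _ _ = handle (Prim p n) n); first exact: der_ax.
  rewrite /mk /handle /= cats0 sa; congr (HGraph _ [:: (_, _)] _).
  rewrite -sa; apply: (@eq_from_nth _ 0); rewrite size_map ?size_iota // => i lti.
  by rewrite (nth_map 0) // nth_iota // index_uniq.
- move=> I E X A I' E' A' d IH pI pE tA w; have w0 := nd_wfs d.
  apply: (der_named IH (mk_inj w0) (mk_inj w) _ _ _ tA (mk_sequent w)).
  + by rewrite !mk_intn.
  + by rewrite (mk_edges w0) (mk_edges w).
  + by rewrite !mk_ext.
- move=> I E X A N D r a0 J F Da0 ri d IH _ /(_ 0)[Js [Fs [eJ eF HJF]]] w.
  have w0 := nd_wfs d.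
  have wND : wf_tp (Div N D).
    by have [_ wE _ _] := w; have [] := wE _ _ (or_introl erefl).
  inversion wND as [|? ? wN wD c1 wl sN|]; subst N0 D0.
  have [d0 Dd0] := (In_onth _ _).1 Da0.
  have [m1 [m2 [eD sd]]] := onth_split Dd0; subst d0.
  set G0 := mk I ((N, map r (ext D)) :: E) X in IH.
  set nm := nth 0 (X ++ I); pose idx := index^~ (X ++ I).
  (* The [N]-edge comes at the head of [G0]. The explicit [[::]] brings the list into the form of
     the replacement lemmas, with position [size [::] = 0]. *)
  have eG0 : edges G0 = [::] ++ (N, map idx (map r (ext D))) :: rn idx E by [].
  have [eN eE] : map nm (map idx (map r (ext D))) = map r (ext D) /\ rn nm (rn idx E) = E.
    by have := mk_edges w0; rewrite -/nm -/G0 eG0 /= => -[-> ->].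
  have wG0 : wf_struct G0 := wf_mk w0.
  pose D' := rmap (dollar_to (Div N D)) D.
  have wD' : wf_struct D' := wf_rmap _ wD.
  have sx : size (N, map idx (map r (ext D))).2 = size (ext D') by rewrite /= !size_map.
  have [uw _ _ _] := w.
  have [||r1 [r1i ext1 eE1 eI1]] := subst1_glue wG0 wD' eG0 sx (rG := nm) (rH := r).
  + by rewrite eN.
  + rewrite (perm_uniq (_ : perm_eq _ ((I ++ X) ++ map r (intn D)))).
      by ucount; apply/uniq_countP => x; move: (uw x); count_lia.
    rewrite perm_cat2r; apply: perm_trans (perm_map nm (perm_nodes wG0)) _.
    by rewrite map_cat mk_intn mk_ext.
  set G1 := subst1 _ _ _ in r1i ext1 eE1 eI1.
  have wG1 : wf_struct G1 := wf_subst wG0 (substitutable1 wD' eG0 sx).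
  rewrite /= eE -[LHS]/(rn r1 (edges G1)) in eE1.
  rewrite mk_intn -[intn D']/(intn D) in eI1; rewrite mk_ext in ext1.
  pose att i := map r (nth (None, [::]) (edges D) i).2.
  pose Hs i := mk (Js i) (Fs i) (att i).
  have HsP j t b : onth (edges D) j = Some (Some t, b) ->
      [/\ att j = map r b, wfs (Js j) (Fs j) (att j) t & der false (Hs j) t].
    move=> Dj; have eatt : att j = map r b by rewrite /att -odflt_onth Dj.
    have [|? ?] := HJF j t (map r b); first by rewrite onth_map Dj.
    by rewrite /Hs eatt.
  have HsW j t b : onth (edges D) j = Some (Some t, b) ->
      wf_struct (Hs j) /\ size b = size (ext (Hs j)).
    move=> /HsP[eb wj _]; split; first exact: wf_mk wj.
    by rewrite size_iota eb size_map.
  have eE1' : rn r1 (edges G1) = [::] ++ rn r (edges D') ++ E by [].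
  have sf := substitutable_divL eD c1 eE1' erefl HsW.
  pose rs i := nth 0 (att i ++ Js i).
  have eIn : pieces (fun j x => if x.1 is Some _ then map (rs j) (intn (Hs j)) else [::])
      0 (rn r (edges D)) = J.
    rewrite eJ; apply: eq_pieces => i y /onth_rn[[[t|] b] Di ->] //=.
    by have [eb wj _] := HsP _ _ _ Di; rewrite add0n mk_intn.
  have eKept : pieces (fun j x => if x.1 is Some _ then rn (rs j) (edges (Hs j)) else [::])
      0 (rn r (edges D)) = F.
    rewrite eF; apply: eq_pieces => i y /onth_rn[[[t|] b] Di ->] //=.
    by have [eb wj _] := HsP _ _ _ Di; rewrite add0n (mk_edges wj).
  have pE2 := kept_divL N Hs eD c1 E r rs (erefl (size [::])).
  have eI2 := internals_divL N Hs eD c1 E r rs (erefl (size [::])).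
  rewrite -[X in pieces _ 0 X]eE1' in eI2; rewrite -[X in pieces _ 0 X]eE1' in pE2.
  have {}eI2 := etrans eI2 eIn.
  have [||r2 [r2i r2_r1 eE2 eI3]] := @subst_glue _ _ _ wG1 sf r1 rs.
  + move=> i x H Gx fi.
    have := onth_divL eD c1 (erefl (size [::])) _ fi.
    move=> /(_ N E r (x.1, map r1 x.2)); rewrite -[X in onth X]eE1' onth_map Gx.
    case=> // j [t [b [ei Dj eH [_ ex]]]]; rewrite ex eH.
    have [eb wj _] := HsP _ _ _ Dj; rewrite ei -eb; exact: mk_ext.
  + rewrite eI2; have n1 := fun x => count_nodes r1 x wG1.
    rewrite eI1 ext1 in n1.
    by ucount; apply/uniq_countP => x; move: (uw x) (n1 x); count_lia.
  set K := subst G1 _ in r2i eE2 eI3.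
  have extK : map r2 (ext K) = X.
    rewrite -ext1; apply/eq_in_map => v vx; apply: r2_r1.
    by have [_ [/allP wx _]] := wG1; apply: wx.
  have {}pE2 : Permutation (rn r2 (edges K)) ((Div N D, map r a0) :: E ++ F).
    by rewrite eE2; move: pE2; rewrite /= eKept.
  have sK : sequent K A := sequent_named w (wf_subst wG1 sf) pE2 extK.
  have dK : der false K A.
    apply: (@der_divL false G0 A N D 0 (size m1) (map idx (map r (ext D))) a0 Hs) => //.
    by move=> i t b Di; have [_ _] := HsP _ _ _ Di.
  apply: (der_named dK r2i (mk_inj w) _ _ _ (teq_refl A) (mk_sequent w)).
  + by rewrite mk_intn eI3 eI1 eI2 catA.
  + by rewrite (mk_edges w); apply: Permutation_eqe.
  + by rewrite extK mk_ext.
- move=> I E X N D a0 Da0 dP IH w.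
  have [u wE wND sX] := w; inversion wND as [|? ? wN wD c1 wl sN|]; subst N0 D0.
  have [d0 Dd0] := (In_onth _ _).1 Da0.
  have [m1 [m2 [eD sd]]] := onth_split Dd0; subst d0.
  have [wa0 ua0] := wD.1 _ Da0; have uX : uniq X by move: u; rewrite cat_uniq => /and3P[].
  have sa : size a0 = size X by rewrite sX (tparity_Div N eD c1).
  have [r [ri ea0 fr]] := fresh_instance (nV D) (I ++ X) ua0 uX sa.
  have u1 : uniq (I ++ map r (iota 0 (nV D))).
    have ui := uniq_map_iota ri.
    move: u; rewrite !cat_uniq ui => /and3P[-> /hasPn dIX _]; rewrite andbT.
    apply/hasPn => _ /mapP[v _ ->]; case: (boolP (v \in a0)) => va.
      by apply: dIX; rewrite -ea0 map_f.
    by have := fr v va; rewrite mem_cat negb_or => /andP[].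
  have d := IH r ri ea0 u1; have w' := nd_wfs (dP r ri ea0 u1).
  pose D' := rmap (dollar_to (Prim 0 0)) D; have wD' : wf_struct D' := wf_rmap _ wD.
  have eD' : edges D' =
    [seq (dollar_to (Prim 0 0) x.1, x.2) | x <- m1] ++ (Prim 0 0, a0) ::
    [seq (dollar_to (Prim 0 0) x.1, x.2) | x <- m2] by rewrite /= eD map_cat.
  have sx : size (Prim 0 0, a0).2 = size (ext (mk I E X)) by rewrite size_iota.
  have [||r' [ri' extr' eE eI]] :=
    subst1_glue wD' (wf_mk w) eD' sx (rG := r) (rH := nth 0 (X ++ I)).
  + by rewrite mk_ext.
  + by rewrite mk_intn uniq_catC.
  have wK := wf_subst wD' (substitutable1 (wf_mk w) eD' sx).
  rewrite -[subst D' _]/(subst1 D' _ _) in wK.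
  rewrite (mk_edges w) in eE; rewrite mk_intn in eI.
  rewrite size_map in ri' extr' eE eI wK.
  have pE : Permutation (rn r' (edges (subst1 D' (size m1) (mk I E X))))
      (somes (rn r (edges D)) ++ E).
    by rewrite eE (somes_divL eD c1 (Prim 0 0)); perm_cat.
  apply: (der_divR Dd0) (mk_sequent w).
  apply: (der_named d (mk_inj w') ri' _ _ _ (teq_refl N) (sequent_named w' wK pE extr')).
  + by rewrite mk_intn eI.
  + by rewrite (mk_edges w'); apply/Permutation_eqe/Permutation_sym.
  + by rewrite mk_ext extr'.
- move=> I E X A M a dP IH w.
  have [u wE _ _] := w; have [wTM sa ua suba] := wE _ _ (or_introl erefl).
  inversion wTM as [| |? wM wl]; subst M0.
  have [r [ri ea fr]] := fresh_instance (nV M) (I ++ X) wM.2.2 ua sa.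
  have u1 : uniq ((I ++ map r (intn M)) ++ X).
    have ui : uniq (map r (intn M)).
      apply: (map_inj_on_uniq ri); last exact: uniq_intn.
      by apply/allP=> v; rewrite mem_intn => /andP[].
    have d0 v : v \in I ++ X -> count_mem v (map r (intn M)) = 0.
      move=> vIX; apply/count_memPn/mapP => -[y]; rewrite mem_intn => /andP[_ yx] ev.
      by have := fr y yx; rewrite -ev vIX.
    ucount; apply/uniq_countP => x; move: (u x) (ui x) (d0 x).
    rewrite mem_countE; count_lia.
  have d := IH r ri ea u1; have w' := nd_wfs (dP r ri ea u1).
  set G0 := mk I _ X; set nm := nth 0 (X ++ I); pose idx := index^~ (X ++ I).
  have wG0 : wf_struct G0 := wf_mk w.
  have eG0 : edges G0 = [::] ++ (Times M, map idx a) :: rn idx E by [].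
  have [eN eE] : map nm (map idx a) = a /\ rn nm (rn idx E) = E.
    by have := mk_edges w; rewrite -/nm -/G0 eG0 /= => -[-> ->].
  have sx : size (Times M, map idx a).2 = size (ext M) by rewrite /= size_map -sa.
  have [||r1 [r1i ext1 eE1 eI1]] := subst1_glue wG0 wM eG0 sx (rG := nm) (rH := r).
  + by rewrite eN.
  + rewrite (perm_uniq (_ : perm_eq _ ((I ++ X) ++ map r (intn M)))).
      by ucount; apply/uniq_countP => x; move: (u1 x); count_lia.
    rewrite perm_cat2r; apply: perm_trans (perm_map nm (perm_nodes wG0)) _.
    by rewrite map_cat mk_intn mk_ext.
  have wK := wf_subst wG0 (substitutable1 wM eG0 sx).
  rewrite -[subst G0 _]/(subst1 G0 _ _) in wK.
  rewrite eE in eE1; rewrite mk_intn in eI1; rewrite mk_ext in ext1.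
  have sK : sequent (subst1 G0 (size ([::] : seq nat)) M) A.
    by apply: (sequent_named w' wK) ext1; rewrite eE1; apply: Permutation_refl.
  apply: (@der_timesL false G0 M A 0 (map idx a)) (mk_sequent w) => //.
  apply: (der_named d (mk_inj w') r1i _ _ _ (teq_refl A) sK).
  + by rewrite mk_intn eI1.
  + by rewrite (mk_edges w') eE1; apply: permR_eqe_refl.
  + by rewrite mk_ext ext1.
- move=> M r J F ri _ /(_ 0)[Js [Fs [eJ eF HJF]]] w.
  have [uw _ wTM _] := w; inversion wTM as [| |? wM wl]; subst M0.
  set T := rn r [seq (Some x.1, x.2) | x <- edges M] in eJ eF HJF.
  pose att i := map r (nth (Prim 0 0, [::]) (edges M) i).2.
  pose Hs i := mk (Js i) (Fs i) (att i).
  pose f i := Some (Hs i).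
  have HsP j t b : onth (edges M) j = Some (t, b) ->
      [/\ att j = map r b, wfs (Js j) (Fs j) (att j) t & der false (Hs j) t].
    move=> Mj; have eatt : att j = map r b by rewrite /att -odflt_onth Mj.
    have [|? ?] := HJF j t (map r b); first by rewrite /T /rn !onth_map Mj.
    by rewrite /Hs eatt.
  have sf : substitutable M f.
    move=> i [t b] H Mi [<-]; have [eb wj _] := HsP _ _ _ Mi.
    by split; [apply: wf_mk wj | rewrite size_iota eb size_map].
  pose rs i := nth 0 (att i ++ Js i).
  have eIn : pieces (internals f rs) 0 (rn r (edges M)) = J.
    rewrite eJ /T /rn !pieces_map; apply: eq_pieces => i [t b] Mi.
    by rewrite /internals /= mk_intn.
  have eKept : pieces (kept_or_edges f rs) 0 (rn r (edges M)) = F.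
    rewrite eF /T /rn !pieces_map; apply: eq_pieces => i [t b] Mi.
    by have [_ wj _] := HsP _ _ _ Mi; rewrite /kept_or_edges /= add0n; apply: mk_edges wj.
  have [||r2 [r2i r2_r eE2 eI2]] := @subst_glue _ _ _ wM sf r rs.
  + move=> i [t b] H Mi [<-]; have [eb _ _] := HsP _ _ _ Mi.
    by rewrite -eb; apply: mk_ext.
  + rewrite eIn; have nM := fun x => count_nodes r x wM.
    by ucount; apply/uniq_countP => x; move: (uw x) (nM x); count_lia.
  rewrite eIn in eI2; rewrite eKept in eE2.
  have extK : map r2 (ext (subst M f)) = map r (ext M).
    apply/eq_in_map => v vx; apply: r2_r.
    by have [_ [/allP wx _]] := wM; apply: wx.
  have pE : Permutation (rn r2 (edges (subst M f))) F by rewrite eE2; apply: Permutation_refl.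
  have sK := sequent_named w (wf_subst wM sf) pE extK.
  have dK : der false (subst M f) (Times M).
    by apply: der_timesR sK => i t b Mi; have [_ _] := HsP _ _ _ Mi.
  apply: (der_named dK r2i (mk_inj w) _ _ _ (teq_refl _) (mk_sequent w)).
  + by rewrite mk_intn eI2.
  + by rewrite (mk_edges w) eE2; apply: permR_eqe_refl.
  + by rewrite mk_ext extK.
- by move=> k; exists (fun _ => [::]), (fun _ => [::]); split=> // -[].
- move=> b T J F _ IH k; have [Js [Fs [eJ eF H]]] := IH k.+1.
  exists Js, Fs; split=> // -[|i] t c //= Ti; by have := H _ _ _ Ti; rewrite addSnnS.
- move=> t b T J1 F1 J F d1 IH1 _ IH k; have [Js [Fs [eJ eF H]]] := IH k.+1.
  exists (fun j => if j == k then J1 else Js j), (fun j => if j == k then F1 else Fs j).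
  rewrite /= eqxx; split.
  + rewrite eJ; congr (_ ++ _); apply: eq_pieces => i [[t'|] c] //= _.
    by rewrite ifF //; lia.
  + rewrite eF; congr (_ ++ _); apply: eq_pieces => i [[t'|] c] //= _.
    by rewrite ifF //; lia.
  + move=> [|i] t' c /=.
      by case=> <- <-; rewrite addn0 eqxx; split=> //; apply: nd_wfs d1.
    move=> Ti; have := H _ _ _ Ti; rewrite addSnnS.
    by rewrite (_ : (k + i.+1 == k) = false) //; lia.
Qed.

Theorem theorem6 (F : hgraph tp) (B : tp) :
  der true F B -> der false F B.
Proof.
move=> d; have sF := der_sequent d; have [[wF _] _] := sF.
(* The node numbers of [F] serve as its names. The graph rebuilt by [mk] may number them
   differently, which the isomorphism rule repairs. *)
have dn := der_nd d (r := id) (fun _ _ _ _ e => e); have w := nd_wfs dn.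
apply: (der_named (nd_der dn) (mk_inj w) (r' := id) _ _ _ _ (teq_refl B) sF) => //.
- by rewrite mk_intn.
- by rewrite (mk_edges w); apply: permR_eqe_refl.
- by rewrite mk_ext.
Qed.
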